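(* Let $n\ge2$ and let $\mathbb{F}_q$ be the finite field with $q=p^f$ elements, $p$ prime. Then 1) $\displaystyle m_{\mathrm{faithful}}(\exp(\mathfrak{f}_{n,2}\otimes_{\mathbb{Z}}\mathbb{F}_q))=\frac{n^2-n}{2}\,f\,q$ for $p\ge3$; 2) $\displaystyle m_{\mathrm{faithful}}(\exp(\mathfrak{f}_{n,3}\otimes_{\mathbb{Z}}\mathbb{F}_q))=\frac{n^3-n}{3}\,f\,q$ for $p\ge5$.
   Context: For a finite group $G$, $m_{\mathrm{faithful}}(G)$ denotes the smallest dimension of a faithful complex representation of $G$. For a finite $\mathbb{Z}$-Lie algebra $L$ of $p$-power order, nilpotent of class less than $p$, $\exp(L)$ is the group with underlying set $L$ and multiplication given by the Baker–Campbell–Hausdorff formula $x*y=x+y+\frac12[x,y]+\frac1{12}[x,[x,y]]+\frac1{12}[y,[y,x]]+\cdots$ (Lazard correspondence). $\mathfrak{f}_{n,c}=\mathfrak{f}_n/\mathfrak{f}_n^{c+1}$ is the free nilpotent $\mathbb{Z}$-Lie algebra of class $c$ on $n$ generators, where $\mathfrak{f}_n$ is the free $\mathbb{Z}$-Lie algebra on $n$ generators and $\mathfrak{f}_n^{k}$ is the $k$-th term of its lower central series, $\mathfrak f_n^1=\mathfrak f_n$. *)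

(* Defs.v *)
From HB Require Import structures.
From mathcomp Require Import all_boot all_order all_algebra all_fingroup.
From mathcomp Require Import all_solvable all_field all_character.
From mathcomp Require Import boolp reals complex ring.

Set Implicit Arguments.
Unset Strict Implicit.
Unset Printing Implicit Defensive.

Import GRing.Theory.
Local Open Scope ring_scope.

HB.mixin Record Zmodule_isLieRing L of GRing.Zmodule L := {
  lie : L -> L -> L;
  lieDl : left_distributive lie +%R;
  lieDr : right_distributive lie +%R;
  liexx : forall x, lie x x = 0;
  lie_jacobi : forall x y z,
    lie x (lie y z) + lie y (lie z x) + lie z (lie x y) = 0
}.

#[short(type="lieRingType")]
HB.structure Definition LieRing := {L of Zmodule_isLieRing L & GRing.Zmodule L}.

#[short(type="finLieRingType")]
HB.structure Definition FinLieRing := {L of LieRing L & Finite L}.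

Notation "⟦ x , y ⟧" := (lie x y) (at level 0, format "⟦ x ,  y ⟧") : ring_scope.

Section LieTheory.
Variable L : lieRingType.
Implicit Types x y z : L.

Lemma lie0l y : ⟦0, y⟧ = 0.
Proof. by apply: (addrI ⟦0, y⟧); rewrite -lieDl !addr0. Qed.

Lemma lie0r x : ⟦x, 0⟧ = 0.
Proof. by apply: (addrI ⟦x, 0⟧); rewrite -lieDr !addr0. Qed.

Lemma lieNl x y : ⟦- x, y⟧ = - ⟦x, y⟧.
Proof. by apply: (addrI ⟦x, y⟧); rewrite -lieDl !subrr lie0l. Qed.

Lemma lieNr x y : ⟦x, - y⟧ = - ⟦x, y⟧.
Proof. by apply: (addrI ⟦x, y⟧); rewrite -lieDr !subrr lie0r. Qed.

Lemma lieC x y : ⟦x, y⟧ = - ⟦y, x⟧.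
Proof.
have := liexx (x + y); rewrite lieDl !lieDr !liexx add0r addr0.
by move/eqP; rewrite addr_eq0 => /eqP.
Qed.

Lemma lieMnl x y k : ⟦x *+ k, y⟧ = ⟦x, y⟧ *+ k.
Proof. by elim: k => [|k IH]; rewrite ?lie0l // !mulrS lieDl IH. Qed.

Lemma lieMnr x y k : ⟦x, y *+ k⟧ = ⟦x, y⟧ *+ k.
Proof. by elim: k => [|k IH]; rewrite ?lie0r // !mulrS lieDr IH. Qed.

Lemma lie_suml (I : Type) (r : seq I) (P : pred I) (F : I -> L) y :
  ⟦\sum_(i <- r | P i) F i, y⟧ = \sum_(i <- r | P i) ⟦F i, y⟧.
Proof. by apply: (big_morph (lie^~ y) _ (lie0l y)) => ? ?; exact: lieDl. Qed.

Lemma lie_sumr (I : Type) (r : seq I) (P : pred I) (F : I -> L) x :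
  ⟦x, \sum_(i <- r | P i) F i⟧ = \sum_(i <- r | P i) ⟦x, F i⟧.
Proof. by apply: (big_morph (lie x) _ (lie0r x)) => ? ?; exact: lieDr. Qed.

Lemma lie_leibniz x y z : ⟦⟦x, y⟧, z⟧ = ⟦x, ⟦y, z⟧⟧ - ⟦y, ⟦x, z⟧⟧.
Proof.
have /eqP := lie_jacobi x y z.
by rewrite addrC addr_eq0 (lieC ⟦x, y⟧) (lieC z x) lieNr => /eqP ->; rewrite opprK.
Qed.

End LieTheory.

Inductive zspan (V : zmodType) (A : V -> Prop) : V -> Prop :=
| zspan0 : zspan A 0
| zspan_gen x : A x -> zspan A x
| zspanB x y : zspan A x -> zspan A y -> zspan A (x - y).

(* L^1 = L and L^(k+1) = [L, L^k]; the value at k = 0 is a convention *)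
Fixpoint lcs (L : lieRingType) (k : nat) : L -> Prop :=
  match k with
  | 0 | 1 => fun=> True
  | (_.+1 as k').+1 =>
      zspan (fun z => exists x y, @lcs L k' y /\ z = ⟦x, y⟧)
  end.
Arguments lcs : clear implicits.

Section LowerCentralSeries.
Variable L : lieRingType.

Lemma lcsS k x y : lcs L k y -> lcs L k.+1 ⟦x, y⟧.
Proof. by case: k => // k ly; apply: zspan_gen; exists x, y. Qed.

Lemma lcs0 k : lcs L k 0.
Proof. by case: k => [|[|k]] //; apply: zspan0. Qed.

Lemma lcsB k x y : lcs L k x -> lcs L k y -> lcs L k (x - y).
Proof. by case: k => [|[|k]] //; apply: zspanB. Qed.

Lemma lcsN k x : lcs L k x -> lcs L k (- x).
Proof. by rewrite -sub0r; apply/lcsB/lcs0. Qed.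

Lemma lcsD k x y : lcs L k x -> lcs L k y -> lcs L k (x + y).
Proof. by move=> lx ly; rewrite -[y]opprK; apply/lcsB/lcsN. Qed.

Lemma lcsW k x : lcs L k.+1 x -> lcs L k x.
Proof.
elim: k x => // -[|k] IH x //; elim=> [|z [u [v [lv ->]]]|u v _ lu _ lv].
- exact: lcs0.
- exact/lcsS/IH.
- exact: lcsB.
Qed.

Lemma lcs_ideal k x y : lcs L k y -> lcs L k ⟦x, y⟧.
Proof. by move=> ly; apply/lcsW/lcsS. Qed.

Definition lcs_pred k : {pred L} := fun x => `[< lcs L k x >].

Lemma lcs_predP k x : reflect (lcs L k x) (x \in lcs_pred k).
Proof. exact: asboolP. Qed.

Lemma lcs_pred_closed k : zmod_closed (lcs_pred k).
Proof.
split=> [|x y /lcs_predP lx /lcs_predP ly]; apply/lcs_predP; first exact: lcs0.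
exact: lcsB.
Qed.

HB.instance Definition _ k := GRing.isZmodClosed.Build L (lcs_pred k) (lcs_pred_closed k).

End LowerCentralSeries.
Arguments lcs_pred : clear implicits.

(* L / L^(c+1) *)
Definition nil_quot (L : lieRingType) (c : nat) : Type := Quotient.quot (lcs_pred L c.+1).

Section NilQuot.
Variables (L : lieRingType) (c : nat).
Local Notation Q := (nil_quot L c).

HB.instance Definition _ := GRing.Zmodule.on Q.

Definition nil_pi (x : L) : Q := (\pi_(Quotient.quot (lcs_pred L c.+1)) x)%qT.

Definition nil_repr (q : Q) : L := generic_quotient.repr (q : Quotient.quot _).

Lemma nil_reprK q : nil_pi (nil_repr q) = q. Proof. exact: reprK. Qed.

Lemma nil_piB : {morph nil_pi : x y / x - y}.
Proof. by move=> x y; rewrite /nil_pi; exact: raddfB. Qed.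
HB.instance Definition _ := GRing.isZmodMorphism.Build L Q nil_pi nil_piB.

Lemma nil_pi_eq x y : nil_pi x = nil_pi y <-> lcs L c.+1 (x - y).
Proof.
by split=> [/eqP|] H; [apply/lcs_predP | apply/eqP; move/lcs_predP: H]; rewrite Quotient.idealrBE.
Qed.

Lemma nil_pi_surj (q : Q) : exists x, q = nil_pi x.
Proof. by exists (nil_repr q); rewrite nil_reprK. Qed.

Definition nil_lie (q r : Q) : Q := nil_pi ⟦nil_repr q, nil_repr r⟧.

Lemma nil_lieE x y : nil_lie (nil_pi x) (nil_pi y) = nil_pi ⟦x, y⟧.
Proof.
rewrite /nil_lie; set x' := nil_repr _; set y' := nil_repr _.
have /nil_pi_eq lx : nil_pi x' = nil_pi x by rewrite nil_reprK.
have /nil_pi_eq ly : nil_pi y' = nil_pi y by rewrite nil_reprK.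
apply/nil_pi_eq.
have -> : ⟦x', y'⟧ - ⟦x, y⟧ = ⟦x', y' - y⟧ - ⟦y, x' - x⟧.
  by rewrite -[- ⟦y, _⟧]lieC lieDl lieDr lieNl lieNr addrA subrK.
by apply: lcsB; apply: lcs_ideal.
Qed.

Fact nil_lieDl : left_distributive nil_lie +%R.
Proof.
move=> a b d; have [[x ->] [[y ->] [z ->]]] := (nil_pi_surj a, (nil_pi_surj b, nil_pi_surj d)).
by rewrite -raddfD !nil_lieE lieDl raddfD.
Qed.

Fact nil_lieDr : right_distributive nil_lie +%R.
Proof.
move=> a b d; have [[x ->] [[y ->] [z ->]]] := (nil_pi_surj a, (nil_pi_surj b, nil_pi_surj d)).
by rewrite -raddfD !nil_lieE lieDr raddfD.
Qed.

Fact nil_liexx a : nil_lie a a = 0.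
Proof. by have [x ->] := nil_pi_surj a; rewrite nil_lieE liexx raddf0. Qed.

Fact nil_lie_jacobi a b d :
  nil_lie a (nil_lie b d) + nil_lie b (nil_lie d a) + nil_lie d (nil_lie a b) = 0.
Proof.
have [[x ->] [[y ->] [z ->]]] := (nil_pi_surj a, (nil_pi_surj b, nil_pi_surj d)).
by rewrite !nil_lieE -!raddfD lie_jacobi raddf0.
Qed.

HB.instance Definition _ := Zmodule_isLieRing.Build Q
  nil_lieDl nil_lieDr nil_liexx nil_lie_jacobi.

Lemma nil_pi_lie x y : nil_pi ⟦x, y⟧ = ⟦nil_pi x, nil_pi y⟧.
Proof. by rewrite -nil_lieE. Qed.

Lemma lcs_nil_quot k q : lcs Q k q -> exists2 x, lcs L k x & q = nil_pi x.
Proof.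
elim: k q => [|[|k] IH] q; try by have [x ->] := nil_pi_surj q; exists x.
elim=> [|z [a [b [/IH[y ly ->] ->]]]|a b _ [x lx ->] _ [y ly ->]].
- by exists 0; [exact: lcs0 | rewrite raddf0].
- by have [x ->] := nil_pi_surj a; exists ⟦x, y⟧; [exact: lcsS | rewrite nil_pi_lie].
- by exists (x - y); [exact: lcsB | rewrite raddfB].
Qed.

Lemma nil_quot_nilpotent q : lcs Q c.+1 q -> q = 0.
Proof.
by case/lcs_nil_quot=> x lx ->; rewrite -(raddf0 nil_pi); apply/nil_pi_eq; rewrite subr0.
Qed.

End NilQuot.

Inductive lie_term (n : nat) : Type :=
| LGen of 'I_n
| LZero
| LOpp of lie_term n
| LAdd of lie_term n & lie_term n
| LLie of lie_term n & lie_term n.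
Arguments LZero {n}.

HB.instance Definition _ n := gen_eqMixin (lie_term n).
HB.instance Definition _ n := gen_choiceMixin (lie_term n).

Fixpoint lie_eval n (L : lieRingType) (g : 'I_n -> L) (t : lie_term n) : L :=
  match t with
  | LGen i => g i
  | LZero => 0
  | LOpp s => - lie_eval g s
  | LAdd s t => lie_eval g s + lie_eval g t
  | LLie s t => ⟦lie_eval g s, lie_eval g t⟧
  end.

Definition lie_term_eqv n : rel (lie_term n) := fun s t =>
  `[< forall (L : lieRingType) (g : 'I_n -> L), lie_eval g s = lie_eval g t >].

Fact lie_term_eqv_refl n : reflexive (@lie_term_eqv n).
Proof. by move=> s; apply/asboolP. Qed.
Fact lie_term_eqv_sym n : symmetric (@lie_term_eqv n).
Proof. by move=> s t; apply/asboolP/asboolP=> H L g; rewrite H. Qed.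
Fact lie_term_eqv_trans n : transitive (@lie_term_eqv n).
Proof. by move=> t s u /asboolP H /asboolP K; apply/asboolP=> L g; rewrite H K. Qed.

Canonical lie_term_equiv n := EquivRel (@lie_term_eqv n)
  (@lie_term_eqv_refl n) (@lie_term_eqv_sym n) (@lie_term_eqv_trans n).

(* Lie expressions in n letters modulo the identities valid in all Lie rings;
   the universal property is free_lieP below *)
Definition free_lie (n : nat) : Type := {eq_quot @lie_term_eqv n}%qT.

Section FreeLie.
Variable n : nat.
Local Notation FL := (free_lie n).

HB.instance Definition _ := Choice.on FL.

Definition flie_pi (t : lie_term n) : FL := (\pi_({eq_quot @lie_term_eqv n}) t)%qT.
Definition flie_repr (u : FL) : lie_term n := generic_quotient.repr (u : {eq_quot @lie_term_eqv n}%qT).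

Lemma flie_reprK u : flie_pi (flie_repr u) = u. Proof. exact: reprK. Qed.

Lemma flie_pi_eq s t : flie_pi s = flie_pi t <->
  forall (L : lieRingType) (g : 'I_n -> L), lie_eval g s = lie_eval g t.
Proof. by split=> [/eqmodP/asboolP|H]; last exact/eqmodP/asboolP. Qed.

Definition free_lift (L : lieRingType) (g : 'I_n -> L) (u : FL) : L := lie_eval g (flie_repr u).

Lemma free_lift_pi (L : lieRingType) (g : 'I_n -> L) t : free_lift g (flie_pi t) = lie_eval g t.
Proof. by move: L g; apply/flie_pi_eq; rewrite flie_reprK. Qed.

Lemma free_lie_ext u v :
  (forall (L : lieRingType) (g : 'I_n -> L), free_lift g u = free_lift g v) -> u = v.
Proof. by move=> H; rewrite -(flie_reprK u) -(flie_reprK v); apply/flie_pi_eq. Qed.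

Definition flie_gen i : FL := flie_pi (LGen i).
Definition flie_zero : FL := flie_pi LZero.
Definition flie_opp u := flie_pi (LOpp (flie_repr u)).
Definition flie_add u v := flie_pi (LAdd (flie_repr u) (flie_repr v)).
Definition flie_lie u v := flie_pi (LLie (flie_repr u) (flie_repr v)).

Fact free_lift0 L g : @free_lift L g flie_zero = 0.
Proof. exact: free_lift_pi. Qed.
Fact free_liftN L g u : @free_lift L g (flie_opp u) = - free_lift g u.
Proof. exact: free_lift_pi. Qed.
Fact free_liftD L g u v : @free_lift L g (flie_add u v) = free_lift g u + free_lift g v.
Proof. exact: free_lift_pi. Qed.
Fact free_liftL L g u v : @free_lift L g (flie_lie u v) = ⟦free_lift g u, free_lift g v⟧.
Proof. exact: free_lift_pi. Qed.

Fact flie_addA : associative flie_add.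
Proof. by move=> u v w; apply: free_lie_ext => L g; rewrite !free_liftD addrA. Qed.
Fact flie_addC : commutative flie_add.
Proof. by move=> u v; apply: free_lie_ext => L g; rewrite !free_liftD addrC. Qed.
Fact flie_add0 : left_id flie_zero flie_add.
Proof. by move=> u; apply: free_lie_ext => L g; rewrite free_liftD free_lift0 add0r. Qed.
Fact flie_addN : left_inverse flie_zero flie_opp flie_add.
Proof.
by move=> u; apply: free_lie_ext => L g; rewrite free_liftD free_liftN free_lift0 addNr.
Qed.

HB.instance Definition _ :=
  GRing.isZmodule.Build FL flie_addA flie_addC flie_add0 flie_addN.

Fact flie_lieDl : left_distributive flie_lie +%R.
Proof.
by move=> u v w; apply: free_lie_ext => L g; rewrite !(free_liftD, free_liftL) lieDl.
Qed.
Fact flie_lieDr : right_distributive flie_lie +%R.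
Proof.
by move=> u v w; apply: free_lie_ext => L g; rewrite !(free_liftD, free_liftL) lieDr.
Qed.
Fact flie_liexx u : flie_lie u u = 0.
Proof. by apply: free_lie_ext => L g; rewrite free_liftL liexx free_lift0. Qed.
Fact flie_lie_jacobi u v w :
  flie_lie u (flie_lie v w) + flie_lie v (flie_lie w u) + flie_lie w (flie_lie u v) = 0.
Proof.
by apply: free_lie_ext => L g; rewrite !(free_liftD, free_liftL) lie_jacobi free_lift0.
Qed.

HB.instance Definition _ :=
  Zmodule_isLieRing.Build FL flie_lieDl flie_lieDr flie_liexx flie_lie_jacobi.

Lemma flie_eval u : u = lie_eval flie_gen (flie_repr u).
Proof.
rewrite -[LHS]flie_reprK; elim: (flie_repr u) => //= [s <-|s <- t <-|s <- t <-];
by apply: free_lie_ext => L g; rewrite ?(free_liftN, free_liftD, free_liftL) !free_lift_pi.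
Qed.

End FreeLie.

Lemma free_lieP n (L : lieRingType) (g : 'I_n -> L) :
  exists! h : free_lie n -> L,
    [/\ {morph h : u v / u + v}, {morph h : u v / ⟦u, v⟧} & forall i, h (flie_gen i) = g i].
Proof.
exists (free_lift g); split=> [|h [hD hL hg]].
  by split=> [u v|u v|i]; [exact: free_liftD|exact: free_liftL|exact: free_lift_pi].
apply/funext=> u; rewrite [in RHS](flie_eval u) /free_lift.
have h0 : h 0 = 0 by apply: (addrI (h 0)); rewrite -hD !addr0.
have hN v : h (- v) = - h v by apply: (addrI (h v)); rewrite -hD !subrr.
by elim: (flie_repr u) => //= [s ->|s -> t ->|s -> t ->].
Qed.

(* f_{n,c} *)
Definition free_nil_lie (n c : nat) : Type := nil_quot (free_lie n) c.
HB.instance Definition _ n c := LieRing.on (free_nil_lie n c).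

Definition biadditive (M N Z : zmodType) (b : M -> N -> Z) : Prop :=
  (forall y, {morph b^~ y : x x' / x + x'}) /\ (forall x, {morph b x : y y' / y + y'}).

Section Tensor.
Variables (M N : zmodType).

Definition formal_eval (Z : zmodType) (b : M -> N -> Z) (s : seq (M * N)) : Z :=
  \sum_(u <- s) b u.1 u.2.

Definition tensor_eqv : rel (seq (M * N)) := fun s t =>
  `[< forall (Z : zmodType) (b : M -> N -> Z), biadditive b -> formal_eval b s = formal_eval b t >].

Fact tensor_eqv_refl : reflexive tensor_eqv.
Proof. by move=> s; apply/asboolP. Qed.
Fact tensor_eqv_sym : symmetric tensor_eqv.
Proof. by move=> s t; apply/asboolP/asboolP=> H Z b bb; rewrite H. Qed.
Fact tensor_eqv_trans : transitive tensor_eqv.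
Proof. by move=> t s u /asboolP H /asboolP K; apply/asboolP=> Z b bb; rewrite H // K. Qed.

Canonical tensor_equiv := EquivRel tensor_eqv tensor_eqv_refl tensor_eqv_sym tensor_eqv_trans.

(* The list [:: (x_1, a_1); ...; (x_k, a_k)] stands for the sum of the x_i (x) a_i,
   and two lists are identified when no biadditive map separates them;
   the universal property is tensorP below *)
Definition tensor : Type := {eq_quot tensor_eqv}%qT.

HB.instance Definition _ := Choice.on tensor.

Definition tens_pi (s : seq (M * N)) : tensor := (\pi_({eq_quot tensor_eqv}) s)%qT.
Definition tens_repr (t : tensor) : seq (M * N) := generic_quotient.repr (t : {eq_quot tensor_eqv}%qT).

Lemma tens_reprK t : tens_pi (tens_repr t) = t. Proof. exact: reprK. Qed.

Lemma tens_pi_eq s t : tens_pi s = tens_pi t <->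
  forall (Z : zmodType) (b : M -> N -> Z), biadditive b -> formal_eval b s = formal_eval b t.
Proof. by split=> [/eqmodP/asboolP|H]; last exact/eqmodP/asboolP. Qed.

Definition tens_lift (Z : zmodType) (b : M -> N -> Z) (t : tensor) : Z :=
  formal_eval b (tens_repr t).

Lemma tens_lift_pi (Z : zmodType) (b : M -> N -> Z) s :
  biadditive b -> tens_lift b (tens_pi s) = formal_eval b s.
Proof. by move: Z b; apply/tens_pi_eq; rewrite tens_reprK. Qed.

Lemma tensor_ext t u :
  (forall (Z : zmodType) (b : M -> N -> Z), biadditive b -> tens_lift b t = tens_lift b u) -> t = u.
Proof. by move=> H; rewrite -(tens_reprK t) -(tens_reprK u); apply/tens_pi_eq. Qed.

Definition pure_tens x a : tensor := tens_pi [:: (x, a)].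
Definition tens_zero : tensor := tens_pi [::].
Definition tens_opp t := tens_pi [seq (- u.1, u.2) | u <- tens_repr t].
Definition tens_add t u := tens_pi (tens_repr t ++ tens_repr u).

Section Lift.
Variables (Z : zmodType) (b : M -> N -> Z).
Hypothesis bb : biadditive b.

Lemma biadd0l y : b 0 y = 0.
Proof. by apply: (addrI (b 0 y)); rewrite -bb.1 !addr0. Qed.
Lemma biadd0r x : b x 0 = 0.
Proof. by apply: (addrI (b x 0)); rewrite -bb.2 !addr0. Qed.
Lemma biaddNl x y : b (- x) y = - b x y.
Proof. by apply: (addrI (b x y)); rewrite -bb.1 !subrr biadd0l. Qed.

Lemma tens_lift0 : tens_lift b tens_zero = 0.
Proof. by rewrite tens_lift_pi // /formal_eval big_nil. Qed.
Lemma tens_liftN t : tens_lift b (tens_opp t) = - tens_lift b t.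
Proof.
rewrite tens_lift_pi // /tens_lift /formal_eval big_map /= -sumrN.
by apply: eq_bigr => u _; rewrite biaddNl.
Qed.
Lemma tens_liftD t u : tens_lift b (tens_add t u) = tens_lift b t + tens_lift b u.
Proof. by rewrite tens_lift_pi // /formal_eval big_cat. Qed.
Lemma tens_lift_pure x a : tens_lift b (pure_tens x a) = b x a.
Proof. by rewrite tens_lift_pi // /formal_eval big_seq1. Qed.

End Lift.

Fact tens_addA : associative tens_add.
Proof. by move=> u v w; apply: tensor_ext => Z b bb; rewrite !tens_liftD // addrA. Qed.
Fact tens_addC : commutative tens_add.
Proof. by move=> u v; apply: tensor_ext => Z b bb; rewrite !tens_liftD // addrC. Qed.
Fact tens_add0 : left_id tens_zero tens_add.
Proof. by move=> u; apply: tensor_ext => Z b bb; rewrite tens_liftD // tens_lift0 // add0r. Qed.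
Fact tens_addN : left_inverse tens_zero tens_opp tens_add.
Proof.
by move=> u; apply: tensor_ext => Z b bb; rewrite tens_liftD // tens_liftN // tens_lift0 // addNr.
Qed.

HB.instance Definition _ :=
  GRing.isZmodule.Build tensor tens_addA tens_addC tens_add0 tens_addN.

Lemma tens_piE s : tens_pi s = \sum_(u <- s) pure_tens u.1 u.2.
Proof.
elim: s => [|u s IH]; first by rewrite big_nil.
rewrite big_cons -IH; apply: tensor_ext => Z b bb.
by rewrite [RHS]tens_liftD // !tens_lift_pi // /formal_eval big_cons big_seq1.
Qed.

Lemma pure_tens_biadditive : biadditive pure_tens.
Proof.
by split=> [y x x'|x y y']; apply: tensor_ext => Z b bb;
   rewrite [RHS]tens_liftD // !tens_lift_pure // ?bb.1 ?bb.2.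
Qed.

Lemma tens_sum t : t = \sum_(u <- tens_repr t) pure_tens u.1 u.2.
Proof. by rewrite -tens_piE tens_reprK. Qed.

End Tensor.

Lemma tensorP (M N Z : zmodType) (b : M -> N -> Z) : biadditive b ->
  exists! h : tensor M N -> Z,
    {morph h : t u / t + u} /\ (forall x a, h (pure_tens x a) = b x a).
Proof.
move=> bb; exists (tens_lift b); split=> [|h [hD hp]].
  by split=> [t u|x a]; [exact: tens_liftD | exact: tens_lift_pure].
apply/funext=> t; rewrite [in RHS](tens_sum t) /tens_lift /formal_eval.
have h0 : h 0 = 0 by apply: (addrI (h 0)); rewrite -hD !addr0.
by rewrite (big_morph h hD h0); apply: eq_bigr => u _; rewrite hp.
Qed.

Section TensorLie.
Variables (M : lieRingType) (A : comPzRingType).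
Local Notation T := (tensor M A).

Lemma tens_ind (P : T -> Prop) :
  P 0 -> (forall x a t, P t -> P (pure_tens x a + t)) -> forall t, P t.
Proof.
move=> P0 PD t; rewrite (tens_sum t).
by elim: (tens_repr t) => [|u s IH]; rewrite ?big_nil // big_cons; apply: PD.
Qed.

Definition tens_lie (t u : T) : T :=
  tens_lift (fun x a => tens_lift (fun y b => pure_tens ⟦x, y⟧ (a * b)) u) t.

Let pureDl := (pure_tens_biadditive M A).1.
Let pureDr := (pure_tens_biadditive M A).2.

Fact tens_lie_biadd1 x a : biadditive (fun y b => pure_tens ⟦x, y⟧ (a * b) : T).
Proof.
by split=> [b y y'|y b b']; rewrite ?lieDr ?mulrDr; [apply: pureDl | apply: pureDr].
Qed.
Local Hint Resolve tens_lie_biadd1 : core.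

Fact tens_lie_biadd2 u :
  biadditive (fun x a => tens_lift (fun y b => pure_tens ⟦x, y⟧ (a * b)) u : T).
Proof.
split=> [a x x'|x a a']; move: u; apply: tens_ind => [|y b u IH];
by rewrite ?tens_lift0 ?addr0 // !tens_liftD // IH !tens_lift_pure //
  ?lieDl ?mulrDl ?pureDl ?pureDr addrACA.
Qed.
Local Hint Resolve tens_lie_biadd2 : core.

Lemma tens_lie_pure x a y b : tens_lie (pure_tens x a) (pure_tens y b) = pure_tens ⟦x, y⟧ (a * b).
Proof. by rewrite /tens_lie !tens_lift_pure. Qed.

Fact tens_lieDl : left_distributive tens_lie +%R.
Proof. by move=> t u v; rewrite /tens_lie tens_liftD. Qed.

Fact tens_lieDr : right_distributive tens_lie +%R.
Proof.
move=> v t u; move: v; apply: tens_ind => [|x a v IH].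
  by rewrite /tens_lie !tens_lift0 ?addr0.
by rewrite !tens_lieDl IH /tens_lie !tens_lift_pure // tens_liftD // addrACA.
Qed.

Fact tens_lie0l t : tens_lie 0 t = 0.
Proof. by apply: (addrI (tens_lie 0 t)); rewrite -tens_lieDl !addr0. Qed.
Fact tens_lie0r t : tens_lie t 0 = 0.
Proof. by apply: (addrI (tens_lie t 0)); rewrite -tens_lieDr !addr0. Qed.

Lemma pure_tens0l a : pure_tens 0 a = 0 :> T.
Proof. by apply: (addrI (pure_tens 0 a)); rewrite -pureDl !addr0. Qed.
Lemma pure_tensNl x a : pure_tens (- x) a = - pure_tens x a :> T.
Proof. by apply: (addrI (pure_tens x a)); rewrite -pureDl !subrr pure_tens0l. Qed.

Fact tens_lieC t u : tens_lie t u = - tens_lie u t.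
Proof.
move: t; apply: tens_ind => [|x a t IHt]; first by rewrite tens_lie0l tens_lie0r oppr0.
rewrite tens_lieDl tens_lieDr opprD IHt; congr (_ + _).
move: u {IHt}; apply: tens_ind => [|y b u IHu]; first by rewrite tens_lie0l tens_lie0r oppr0.
by rewrite tens_lieDl tens_lieDr opprD IHu !tens_lie_pure lieC mulrC pure_tensNl.
Qed.

Fact tens_liexx t : tens_lie t t = 0.
Proof.
move: t; apply: tens_ind => [|x a t IH]; first exact: tens_lie0l.
rewrite !tens_lieDl !tens_lieDr IH addr0 tens_lie_pure liexx pure_tens0l add0r.
by rewrite [X in _ + X]tens_lieC subrr.
Qed.

Fact tens_lie_jacobi t u v :
  tens_lie t (tens_lie u v) + tens_lie u (tens_lie v t) + tens_lie v (tens_lie t u) = 0.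
Proof.
have E0 := (tens_lie0l, tens_lie0r, addr0); have ED := (tens_lieDl, tens_lieDr).
have jacD (a b d a' b' d' : T) : a + b + d = 0 -> a' + b' + d' = 0 ->
    a + a' + (b + b') + (d + d') = 0.
  by move=> H K; rewrite (addrACA a) (addrACA (a + b)) H K addr0.
move: t; apply: tens_ind => [|x a t IHt]; first by rewrite !E0.
rewrite !ED; apply: (jacD) IHt.
move: u; apply: tens_ind => [|y b u IHu]; first by rewrite !E0.
rewrite !ED; apply: (jacD) IHu.
move: v; apply: tens_ind => [|z d v IHv]; first by rewrite !E0.
rewrite !ED; apply: (jacD) IHv.
have e1 : b * (d * a) = a * (b * d) by rewrite mulrA mulrC.
have e2 : d * (a * b) = a * (b * d) by rewrite mulrC -mulrA.
rewrite !tens_lie_pure e1 e2 -!pureDl.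
by rewrite lie_jacobi pure_tens0l.
Qed.

HB.instance Definition _ :=
  Zmodule_isLieRing.Build T tens_lieDl tens_lieDr tens_liexx tens_lie_jacobi.

Lemma lcs_tensor k (t : T) : lcs T k t ->
  zspan (fun t => exists x a, lcs M k x /\ t = pure_tens x a) t.
Proof.
have zD (B : T -> Prop) u v : zspan B u -> zspan B v -> zspan B (u + v).
  move=> Bu Bv; rewrite -[v]opprK -(sub0r v); do 2?apply: zspanB => //; exact: zspan0.
elim: k t => [|[|k] IH] t.
- move=> _; move: t; apply: tens_ind => [|x a t IHt]; first exact: zspan0.
  by apply: zD IHt; apply: zspan_gen; exists x, a.
- move=> _; move: t; apply: tens_ind => [|x a t IHt]; first exact: zspan0.
  by apply: zD IHt; apply: zspan_gen; exists x, a.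
elim=> [|z [u [v [/IH lv ->]]]|u v _ lu _ lv]; [exact: zspan0| |exact: zspanB].
elim: lv => [|_ [y [b [ly ->]]]|v1 v2 _ l1 _ l2].
- by rewrite lie0r; apply: zspan0.
- move: u; apply: tens_ind => [|x a u IHu]; first by rewrite lie0l; apply: zspan0.
  rewrite lieDl; apply: zD IHu; apply: zspan_gen; exists ⟦x, y⟧, (a * b).
  by split; [exact: lcsS | exact: tens_lie_pure].
- by rewrite lieDr lieNr; apply: zspanB.
Qed.

End TensorLie.

(* f_{n,c} (x) A *)
Definition free_nil_tensor (n c : nat) (A : comPzRingType) : Type := tensor (free_nil_lie n c) A.
HB.instance Definition _ n c A := LieRing.on (free_nil_tensor n c A).

Lemma free_nil_tensor_nilpotent n c (A : comPzRingType) (t : free_nil_tensor n c A) :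
  lcs (free_nil_tensor n c A) c.+1 t -> t = 0.
Proof.
move/(@lcs_tensor (free_nil_lie n c) A); elim=> // [_ [x [a [lx ->]]]|u v _ -> _ ->].
  by rewrite (nil_quot_nilpotent lx) pure_tens0l.
by rewrite subrr.
Qed.

Section Finiteness.
Variables n c : nat.

Fixpoint lie_word (w : seq 'I_n) : free_lie n :=
  match w with
  | [::] => 0
  | [:: i] => flie_gen i
  | i :: w' => ⟦flie_gen i, lie_word w'⟧
  end.

Lemma lie_word_lcs w : lcs (free_lie n) (size w) (lie_word w).
Proof. by elim: w => // i [|j w] // IH; apply: lcsS. Qed.

Lemma lie_word_span u : zspan (fun v => exists w, v = lie_word w) u.
Proof.
set S := zspan _.
have SN v : S v -> S (- v) by rewrite -sub0r; apply: zspanB; exact: zspan0.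
have Sgen i v : S v -> S ⟦flie_gen i, v⟧.
  elim=> [|_ [[|j w] ->]|v1 v2 _ S1 _ S2]; rewrite ?lie0r; try exact: zspan0.
    by apply: zspan_gen; exists [:: i, j & w].
  by rewrite lieDr lieNr; apply: zspanB.
have Sword w v : S v -> S ⟦lie_word w, v⟧.
  elim: w v => [|i [|j w] IH] v Sv; rewrite ?lie0l; [exact: zspan0|exact: Sgen|].
  by rewrite [lie_word _]/= lie_leibniz; apply: zspanB; [apply/Sgen/IH|apply/IH/Sgen].
have SL v1 v2 : S v1 -> S v2 -> S ⟦v1, v2⟧.
  move=> S1 S2; elim: S1 => [|_ [w ->]|u1 u2 _ T1 _ T2]; rewrite ?lie0l ?lieDl ?lieNl.
  - exact: zspan0.
  - exact: Sword.
  - exact: zspanB.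
rewrite (flie_eval u); elim: (flie_repr u) => /= [i||s|s Ss t St|s Ss t St].
- by apply: zspan_gen; exists [:: i].
- exact: zspan0.
- exact: SN.
- by rewrite -[lie_eval _ t]opprK; apply/zspanB/SN.
- exact: SL.
Qed.

Variable F : finFieldType.
Local Notation T := (free_nil_tensor n c F).
Local Notation D := {k : 'I_c.+1 & k.-tuple 'I_n}.

Definition tens_comb (g : {ffun D -> F}) : T :=
  \sum_(d : D) pure_tens (nil_pi c (lie_word (tagged d))) (g d).

Lemma tens_combB g h : tens_comb (g - h) = tens_comb g - tens_comb h.
Proof.
have [_ pDr] := pure_tens_biadditive (free_nil_lie n c) F.
apply: (canRL (addrK _)); rewrite -big_split; apply: eq_bigr => d _ /=.
by rewrite -pDr !ffunE subrK.
Qed.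

Lemma tens_comb0 : tens_comb 0 = 0.
Proof. by rewrite -[in LHS](subrr 0) tens_combB subrr. Qed.

Lemma tens_combP (t : T) : exists g, tens_comb g = t.
Proof.
have [pDl pDr] := pure_tens_biadditive (free_nil_lie n c) F.
move: t; apply: tens_ind => [|x a t [h <-]]; first by exists 0; exact: tens_comb0.
suff [g <-] : exists g, tens_comb g = pure_tens x a.
  by exists (g - (0 - h)); rewrite !tens_combB tens_comb0 sub0r opprK.
have [u ->] := nil_pi_surj x.
elim: (lie_word_span u) => [|_ [w ->]|u1 u2 _ [g1 E1] _ [g2 E2]].
- by exists 0; rewrite raddf0 tens_comb0 pure_tens0l.
- have [lew|ltw] := leqP (size w) c; last first.
    exists 0; rewrite tens_comb0; suff -> : nil_pi c (lie_word w) = 0 by rewrite pure_tens0l.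
    rewrite -(raddf0 (nil_pi c)); apply/nil_pi_eq; rewrite subr0.
    have := lie_word_lcs w; rewrite -(subnKC ltw).
    by elim: (size w - c.+1)%N => [|k IH]; rewrite ?addn0 // addnS => /lcsW.
  pose d : D := existT _ (Ordinal (lew : size w < c.+1)%N) (in_tuple w).
  exists [ffun e => if e == d then a else 0].
  rewrite /tens_comb (bigD1 d) //= ffunE eqxx big1 ?addr0 // => e /negbTE ne.
  by rewrite ffunE ne; apply: biadd0r; exact: pure_tens_biadditive.
- exists (g1 - g2); rewrite tens_combB E1 E2 raddfB.
  by rewrite -[- pure_tens _ _]pure_tensNl -pDl.
Qed.

Definition tens_coord (t : T) : {ffun D -> F} := sval (cid (tens_combP t)).

Lemma tens_coordK : cancel tens_coord tens_comb.
Proof. by move=> t; rewrite /tens_coord; case: cid. Qed.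

HB.instance Definition _ := Choice_isCountable.Build T (pcan_pickleK (can_pcan tens_coordK)).
HB.instance Definition _ : isFinite T := CanIsFinite tens_coordK.

End Finiteness.

Section ZmodNormalization.

Inductive zterm := ZVar of nat | ZAdd of zterm & zterm | ZOpp of zterm | ZMul of zterm & nat.

Fixpoint zeval (V : zmodType) (env : seq V) (e : zterm) : V :=
  match e with
  | ZVar i => nth 0 env i
  | ZAdd e1 e2 => zeval env e1 + zeval env e2
  | ZOpp e1 => - zeval env e1
  | ZMul e1 k => zeval env e1 *+ k
  end.

Fixpoint zcoef (e : zterm) (i : nat) : int :=
  match e with
  | ZVar j => (i == j)%:Z
  | ZAdd e1 e2 => zcoef e1 i + zcoef e2 i
  | ZOpp e1 => - zcoef e1 i
  | ZMul e1 k => zcoef e1 i *+ k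
  end.

Lemma zevalE (V : zmodType) (env : seq V) e :
  zeval env e = \sum_(i < size env) env`_i *~ zcoef e i.
Proof.
elim: e => [j|e1 IH1 e2 IH2|e1 IH1|e1 IH1 k] /=; rewrite ?IH1 ?IH2.
- have [ltj|lej] := ltnP j (size env).
    rewrite (bigD1 (Ordinal ltj)) //= eqxx big1 ?addr0 // => i /eqP ne.
    by case: eqP => // eij; case: ne; apply: val_inj.
  rewrite nth_default // big1 // => i _; case: eqP => // eij.
  by move: lej; rewrite -eij leqNgt ltn_ord.
- by rewrite -big_split; apply: eq_bigr => i _; rewrite mulrzDr.
- by rewrite -sumrN; apply: eq_bigr => i _; rewrite mulrNz.
- by rewrite -sumrMnl; apply: eq_bigr => i _; rewrite pmulrn -mulrzA -mulr_natr natz.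
Qed.

Lemma zeval_eq (V : zmodType) (env : seq V) e1 e2 :
  all (fun i => zcoef e1 i == zcoef e2 i) (iota 0 (size env)) -> zeval env e1 = zeval env e2.
Proof.
move=> /allP H; rewrite !zevalE; apply: eq_bigr => i _.
by rewrite (eqP (H i _)) // mem_iota ltn_ord.
Qed.

End ZmodNormalization.

Ltac zmod_index x env :=
  match env with
  | ?y :: _ => let _ := match goal with _ => unify x y end in constr:(0%N)
  | _ :: ?env' => let i := zmod_index x env' in constr:(i.+1)
  end.

Ltac zmod_reify env t :=
  match t with
  | _ => let i := zmod_index t env in constr:(ZVar i)
  | ?t1 + ?t2 =>
      let e1 := zmod_reify env t1 in let e2 := zmod_reify env t2 in constr:(ZAdd e1 e2)
  | - ?t1 => let e1 := zmod_reify env t1 in constr:(ZOpp e1)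
  | ?t1 *+ ?k => let e1 := zmod_reify env t1 in constr:(ZMul e1 k)
  end.

(* decides equalities of integral linear combinations of the terms listed in env *)
Ltac zmod_eq env :=
  lazymatch goal with
  | |- ?t1 = ?t2 =>
      let e1 := zmod_reify env t1 in let e2 := zmod_reify env t2 in
      exact: (@zeval_eq _ env e1 e2 (erefl true))
  end.

Section GroupLaw.
Variables (L : lieRingType) (a b : nat).
Hypothesis lie2 : forall x y : L, ⟦x, y⟧ *+ (2 * a) = ⟦x, y⟧.
Hypothesis lie3 : forall x y z : L, ⟦x, ⟦y, z⟧⟧ *+ (12 * b) = ⟦x, ⟦y, z⟧⟧.
Hypothesis lie4 : forall x y z t : L, ⟦x, ⟦y, ⟦z, t⟧⟧⟧ = 0.

Let op (x y : L) : L := x + y + ⟦x, y⟧ *+ a + ⟦x, ⟦x, y⟧⟧ *+ b + ⟦y, ⟦y, x⟧⟧ *+ b.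

Let lie4' (x y z t : L) : ⟦⟦x, y⟧, ⟦z, t⟧⟧ = 0.
Proof. by rewrite lie_leibniz !lie4 subrr. Qed.

Let lie3aa (x y z : L) : ⟦x, ⟦y, z⟧⟧ *+ a *+ a = ⟦x, ⟦y, z⟧⟧ *+ b *+ 3.
Proof.
transitivity (⟦x, ⟦y, z⟧⟧ *+ (2 * a) *+ (2 * a) *+ b *+ 3); last by rewrite !lie2.
by rewrite -[in LHS]lie3 -!mulrnA; congr (_ *+ _); ring.
Qed.

Let op_lie x y z : ⟦op x y, z⟧ = ⟦x, z⟧ + ⟦y, z⟧ + ⟦⟦x, y⟧, z⟧ *+ a.
Proof.
by rewrite /op !lieDl !lieMnl !(lieC ⟦_, ⟦_, _⟧⟧) !lie4 oppr0 !mul0rn !addr0.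
Qed.

Let lie_op x y z : ⟦z, op x y⟧ = ⟦z, x⟧ + ⟦z, y⟧ + ⟦z, ⟦x, y⟧⟧ *+ a.
Proof. by rewrite /op !lieDr !lieMnr !lie4 !mul0rn !addr0. Qed.

Fact bch3_assoc : associative op.
Proof.
have opE u v : op u v = u + v + ⟦u, v⟧ *+ a + ⟦u, ⟦u, v⟧⟧ *+ b + ⟦v, ⟦v, u⟧⟧ *+ b by [].
move=> x y z; rewrite [LHS]opE [RHS]opE !op_lie !lie_op.
rewrite !(lieDr, lieDl, lieMnr, lieMnl) ?op_lie ?lie_op.
rewrite !(lie4, lie4', mul0rn, addr0, lieDr, lieDl, lieMnr, lieMnl).
have jac : ⟦z, ⟦x, y⟧⟧ = ⟦y, ⟦x, z⟧⟧ - ⟦x, ⟦y, z⟧⟧.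
  by rewrite (lieC z) lie_leibniz opprB.
rewrite !opE !lie_leibniz !(lieDr, lieNr, lie4, subr0, oppr0, mul0rn, addr0).
rewrite (lieC y x) (lieC z x) (lieC z y) !lieNr !jac.
rewrite !(mulrnDl, mulNrn, opprD, opprK) !lie3aa.
zmod_eq [:: x; y; z; ⟦x, y⟧ *+ a; ⟦x, z⟧ *+ a; ⟦y, z⟧ *+ a;
  ⟦x, ⟦x, y⟧⟧ *+ b; ⟦x, ⟦x, z⟧⟧ *+ b; ⟦x, ⟦y, z⟧⟧ *+ b; ⟦y, ⟦x, y⟧⟧ *+ b;
  ⟦y, ⟦x, z⟧⟧ *+ b; ⟦y, ⟦y, z⟧⟧ *+ b; ⟦z, ⟦x, z⟧⟧ *+ b; ⟦z, ⟦y, z⟧⟧ *+ b].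
Qed.

Fact bch3_0 x : op 0 x = x.
Proof. by rewrite /op !(lie0l, lie0r) !mul0rn !addr0 add0r. Qed.

Fact bch3_N x : op (- x) x = 0.
Proof.
by rewrite /op !(lieNl, lieNr, liexx, lie0r) !oppr0 ?lie0r !(mul0rn, oppr0, addr0) addNr.
Qed.

End GroupLaw.

Section Exp.
Variable L : finLieRingType.
Implicit Types x y z v : L.

(* v / m, that is, the unique w such that w *+ m = v, when m is coprime to #|L|: the first
   component of egcdn m #|L| is then an inverse of m modulo #|L| *)
Definition lie_divn v (m : nat) : L := v *+ (egcdn m #|L|).1.

Lemma lie_cardMn v : v *+ #|L| = 0.
Proof.
apply: (addrI (\sum_(u : L) u)); rewrite addr0 [RHS](reindex_inj (addIr v)).
by rewrite big_split sumr_const.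
Qed.

Lemma lie_divnK v m : (0 < m)%N -> coprime m #|L| -> lie_divn v m *+ m = v.
Proof.
move=> m_gt0 /eqP co; rewrite /lie_divn -mulrnA; case: egcdnP => //= k j -> _.
by rewrite co mulrnDr mulnC mulrnA lie_cardMn mul0rn add0r.
Qed.

(* The Baker-Campbell-Hausdorff series; the terms of degree at least 4 vanish in class at most 3 *)
Definition bch x y : L :=
  x + y + lie_divn ⟦x, y⟧ 2 + lie_divn ⟦x, ⟦x, y⟧⟧ 12 + lie_divn ⟦y, ⟦y, x⟧⟧ 12.

(* L has p-power order and nilpotency class at most c < p; the bound c <= 3 is what makes
   the truncation in bch exact *)
Definition lazard_lie : Prop := exists p c : nat,
  [/\ prime p, p.-nat #|L|, (c < p)%N, (c <= 3)%N & forall x, lcs L c.+1 x -> x = 0].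

Lemma lazard_lie_bounds : lazard_lie ->
  [/\ forall x y, ⟦x, y⟧ *+ (2 * (egcdn 2 #|L|).1) = ⟦x, y⟧,
      forall x y z, ⟦x, ⟦y, z⟧⟧ *+ (12 * (egcdn 12 #|L|).1) = ⟦x, ⟦y, z⟧⟧
    & forall x y z t, ⟦x, ⟦y, ⟦z, t⟧⟧⟧ = 0].
Proof.
move=> [p [c [p_pr pL ltcp lec nil]]].
have nil_le k x : (c < k)%N -> lcs L k x -> x = 0.
  move=> ltck lx; apply: nil; move: lx; rewrite -(subnKC ltck).
  by elim: (k - c.+1)%N => [|j IH]; rewrite ?addn0 // addnS => /lcsW.
have l2 x y : lcs L 2 ⟦x, y⟧ by exact: lcsS.
have l3 x y z : lcs L 3 ⟦x, ⟦y, z⟧⟧ by exact: lcsS.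
have co m : ~~ (p %| m)%N -> coprime m #|L|.
  by move=> npm; rewrite coprime_sym; apply: (pnat_coprime pL); rewrite p'natE.
have cop m v : (0 < m)%N -> ~~ (p %| m)%N -> v *+ (m * (egcdn m #|L|).1) = v.
  by move=> m0 npm; rewrite mulnC mulrnA; apply/lie_divnK/co.
split=> [x y|x y z|x y z t]; last by apply: (nil_le 4) => //; do 3!apply: lcsS.
- have [le2c|gt2c] := leqP c 1; first by rewrite (nil_le 2 _ _ (l2 x y)) // mul0rn.
  by apply: cop => //; rewrite gtnNdvd // (leq_ltn_trans _ ltcp).
- have [le2c|gt2c] := leqP c 2; first by rewrite (nil_le 3 _ _ (l3 x y z)) // mul0rn.
  apply: cop => //; rewrite (Euclid_dvdM 4 3) // (Euclid_dvdM 2 2) // orbb.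
  by rewrite negb_or !gtnNdvd // (leq_ltn_trans _ ltcp) // ltnW.
Qed.

(* The additive group is a junk value for the Lie rings outside lazard_lie;
   see free_nil_lazard for the ones of interest *)
Definition exp_mul x y : L := if `[< lazard_lie >] then bch x y else x + y.

Fact exp_mulA : associative exp_mul.
Proof.
rewrite /exp_mul; case: asboolP => [/lazard_lie_bounds[H2 H3 H4]|_]; last exact: addrA.
exact: (bch3_assoc H2 H3 H4).
Qed.

Fact exp_mul0 : left_id 0 exp_mul.
Proof. by move=> x; rewrite /exp_mul; case: asboolP => _; [exact: bch3_0 | exact: add0r]. Qed.

Fact exp_mulN : left_inverse 0 -%R exp_mul.
Proof. by move=> x; rewrite /exp_mul; case: asboolP => _; [exact: bch3_N | exact: addNr]. Qed.

Definition exp_lie : Type := L.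
HB.instance Definition _ := Finite.on exp_lie.
HB.instance Definition _ := Finite_isGroup.Build exp_lie exp_mulA exp_mul0 exp_mulN.

Lemma exp_lieE (x y : exp_lie) : (x * y)%g = exp_mul x y. Proof. by []. Qed.

Lemma exp_lieM (x y : exp_lie) : lazard_lie -> (x * y)%g = bch x y.
Proof. by move=> lL; rewrite exp_lieE /exp_mul asboolT. Qed.

Lemma exp_lieX (x : exp_lie) k : (x ^+ k)%g = (x : L) *+ k.
Proof.
elim: k => // k IH; rewrite expgS IH mulrS exp_lieE /exp_mul; case: asboolP => // _.
by rewrite /bch /lie_divn !(lieMnr, lieMnl, liexx, lie0r, mul0rn, addr0).
Qed.

Lemma pnat_card_lie p : (forall v : L, v *+ p = 0) -> prime p -> p.-nat #|L|.
Proof.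
move=> pL p_pr; apply/pnatP=> [|r r_pr rL]; first by apply/card_gt0P; exists 0.
have rG : (r %| #|[set: exp_lie]|)%N by rewrite cardsT.
have [x _ ox] := Cauchy r_pr rG.
have : (#[x]%g %| p)%N by rewrite order_dvdn exp_lieX pL.
by rewrite ox dvdn_prime2.
Qed.

End Exp.

Lemma free_nil_lazard n c p f (F : finFieldType) :
  prime p -> #|F| = (p ^ f)%N -> (c < p)%N -> (c <= 3)%N ->
  lazard_lie (free_nil_tensor n c F).
Proof.
move=> p_pr cF ltcp lec; exists p, c; split=> //; last exact: free_nil_tensor_nilpotent.
apply: (pnat_card_lie) (p_pr) => t.
have chF := card_finPcharP cF p_pr.
have [_ pDr] := pure_tens_biadditive (free_nil_lie n c) F.
move: t; apply: tens_ind => [|x a t IH]; first exact: mul0rn.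
rewrite mulrnDl IH addr0; suff <- : pure_tens x (a *+ p) = pure_tens x a *+ p.
  by rewrite (mulrn_pchar chF) biadd0r //; exact: pure_tens_biadditive.
by elim: p {p_pr cF ltcp IH chF} => [|k IHk]; rewrite ?biadd0r ?mulrS ?pDr ?IHk //;
  exact: pure_tens_biadditive.
Qed.

Section FaithfulDimension.
Variables (R : realType) (gT : finGroupType) (G : {group gT}).

Definition has_faithful_repr (d : nat) : Prop :=
  exists rG : mx_representation R[i] G d, mx_faithful rG.

Fact has_faithful_repr_ex : exists d, `[< has_faithful_repr d >].
Proof.
exists #|G|; apply/asboolP; exists (regular_repr R[i] G); exact: regular_mx_faithful.
Qed.

Definition m_faithful : nat := ex_minn has_faithful_repr_ex.

Lemma m_faithfulP :
  has_faithful_repr m_faithful /\ forall d, has_faithful_repr d -> (m_faithful <= d)%N.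
Proof. by rewrite /m_faithful; case: ex_minnP => m /asboolP ? H; split=> // d /asboolP/H. Qed.

End FaithfulDimension.
Arguments m_faithful R {gT} G%_G.

(* Main.v *)
From HB Require Import structures.
Require Import Defs.
From mathcomp Require Import all_boot all_order all_algebra all_fingroup all_field reals.
From mathcomp Require Import mxrepresentation complex ring zify.

(* Let L = f_{n,c} (x) F_q, let d = (n^c - n) / c, and let psi be a nontrivial additive character
   of F_q.

   Lower bound. The Hall basis of L^c spans a central subspace V of dimension d, on which the BCH
   product is the sum. The projections of a faithful representation on the isotypic components of
   the characters psi(w . x) of V sum to the identity, so the characters that occur separate the
   points of V. Their values are p-th roots of unity and #|V| = p^(f d), so at least f d nontrivial
   characters occur. If w is nonzero on the line of a basis vector [e_i, r], the conjugates of an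
   element a r of F_q r by F_q e_i are its products with elements of V on which w takes all values,
   whence the trace of a r on the component of w vanishes for a <> 0, and q divides the dimension
   of this component.

   Upper bound. Each Hall basis vector has a morphism of L to a Lie algebra spanned by X, Y, W, Z
   with [X, Y] = eps W and [X, W] = Z attached to it, such that the coordinates of Z form a basis of
   the dual of L^c. The group of this Lie algebra acts on the functions on F_q through each additive
   character of F_q, with exp(a X) acting as the translation by a and the abelian ideal <Y, W, Z> by
   multiplications. The sum of these representations over the d basis vectors and f characters that
   separate the points of F_q is faithful, of dimension d f q. *)

Set Implicit Arguments.
Unset Strict Implicit.
Unset Printing Implicit Defensive.

Import GRing.Theory Num.Theory.
Local Open Scope ring_scope.

(** * Lower bound for the degree *)

(** Factor [A] as [C *m B] through its rank. Cancelling the full-rank outer factors in [A *m A = A]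
    gives [B *m C = 1], an identity matrix whose size is the rank. *)
Lemma mxtrace_idem (K : fieldType) d (A : 'M[K]_d) : A *m A = A -> \tr A = (\rank A)%:R.
Proof.
move=> AA.
have [B' BB'] := row_freeP (row_base_free A).
have [C' CC'] := row_fullP (col_base_full A).
have := mulmx_base A; move: (col_base A) (row_base A) B' C' BB' CC' => C B B' C' BB' CC' CB.
suff BC : B *m C = 1%:M by rewrite -[in LHS]CB mxtrace_mulC BC mxtrace1.
have : C' *m (C *m (B *m C - 1%:M) *m B) *m B' = 0.
  suff -> : C *m (B *m C - 1%:M) *m B = 0 by rewrite mulmx0 mul0mx.
  by rewrite mulmxBr mulmx1 mulmxBl mulmxA CB -mulmxA CB AA subrr.
by rewrite !mulmxA CC' mul1mx -mulmxA BB' mulmx1 => /eqP; rewrite subr_eq0 => /eqP.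
Qed.

Section Averages.
Variables (K : numFieldType) (d : nat) (U : finType) (op : U -> U -> U) (M : U -> 'M[K]_d).
Hypothesis op_inj : forall u, injective (op u).
Hypothesis M_op : forall u v, M (op u v) = M u *m M v.

Definition avg_mx : 'M[K]_d := #|U|%:R^-1 *: \sum_u M u.

Lemma mul_avg_mx u : M u *m avg_mx = avg_mx.
Proof.
rewrite -scalemxAr mulmx_sumr; congr (_ *: _).
by rewrite [RHS](reindex_inj (@op_inj u)); apply: eq_bigr => v _; rewrite -M_op.
Qed.

Lemma avg_mx_idem : avg_mx *m avg_mx = avg_mx.
Proof.
rewrite {1}/avg_mx -scalemxAl mulmx_suml (eq_bigr (fun=> avg_mx)) => [|u _]; last exact: mul_avg_mx.
rewrite sumr_const -scaler_nat scalerA /avg_mx.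
have [U0|nU] := eqVneq #|U| 0%N; last by rewrite mulVf ?scale1r // pnatr_eq0.
by rewrite big1 ?scaler0 // => u; move: (fintype0 u U0).
Qed.

End Averages.

Section FpCharacter.
Variables (K : fieldType) (p : nat) (zeta : K).
Hypotheses (p_prime : prime p) (zetaX : zeta ^+ p = 1) (zeta_neq1 : zeta != 1).

Definition Fp_char (x : 'F_p) : K := zeta ^+ x.

Lemma Fp_charD x y : Fp_char (x + y) = Fp_char x * Fp_char y.
Proof. by rewrite /Fp_char -exprD /= [X in (_ %% X)%N]Fp_cast // expr_mod. Qed.

Lemma Fp_char0 : Fp_char 0 = 1. Proof. by []. Qed.

(** Since p is prime and [zeta] is not 1, [zeta] has order exactly p. *)
Lemma Fp_char_eq1 x : (Fp_char x == 1) = (x == 0).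
Proof.
apply/eqP/eqP => [|->]; last exact: Fp_char0.
have [m zm mp] := prim_order_exists (prime_gt0 p_prime) zetaX.
have mE : m = p.
  case/primeP: p_prime => _ /(_ _ mp)/orP[/eqP m1|/eqP //].
  by move: zm; rewrite m1 => /prim_expr_order; rewrite expr1 => /eqP; rewrite (negbTE zeta_neq1).
rewrite {}mE in zm; move/eqP; rewrite -(expr0 zeta) (eq_prim_root_expr zm) mod0n.
rewrite modn_small ?[X in (_ < X)%N](esym (Fp_cast p_prime)) ?ltn_ord // => /eqP x0.
exact: val_inj.
Qed.

End FpCharacter.

Section LowerBound.
Variables (K : numFieldType) (F : finFieldType) (p f : nat) (zeta : K) (tau : {additive F -> 'F_p}).
Hypotheses (p_prime : prime p) (zetaX : zeta ^+ p = 1) (zeta_neq1 : zeta != 1).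
Hypothesis tau_neq0 : exists x, tau x != 0.
Hypothesis card_F : #|F| = (p ^ f)%N.

Let card_neq0 (U : finType) (u : U) : #|U|%:R != 0 :> K.
Proof. by rewrite pnatr_eq0 -lt0n; apply/card_gt0P; exists u. Qed.

Let psi x := Fp_char zeta (tau x).

Let psiD x y : psi (x + y) = psi x * psi y.
Proof. by rewrite /psi raddfD Fp_charD. Qed.

Let psi0 : psi 0 = 1.
Proof. by rewrite /psi raddf0 Fp_char0. Qed.

Variable H : finType.
Local Notation V := {ffun H -> F}.

Let addVI (u : V) : injective (fun v : V => u + v) := @addrI _ u.

Definition dotff (w x : V) : F := \sum_h w h * x h.

Lemma dotffDr w x y : dotff w (x + y) = dotff w x + dotff w y.
Proof. by rewrite -big_split; apply: eq_bigr => h _; rewrite ffunE mulrDr. Qed.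

Lemma dotffDl w v x : dotff (w + v) x = dotff w x + dotff v x.
Proof. by rewrite -big_split; apply: eq_bigr => h _; rewrite ffunE mulrDl. Qed.

Lemma dotff0 w : dotff w 0 = 0.
Proof. by apply: (addrI (dotff w 0)); rewrite -dotffDr !addr0. Qed.

Lemma dot0ff x : dotff 0 x = 0.
Proof. by apply: (addrI (dotff 0 x)); rewrite -dotffDl !addr0. Qed.

(** Orthogonality of characters: for x <> 0, translating w by some w0 with psi(w0 . x) <> 1
    multiplies the sum by that value. *)
Lemma sum_psi_dotff x : \sum_w psi (dotff w x) = if x == 0 then #|{: V}|%:R else 0.
Proof.
case: eqP => [->|/eqP nx].
  by rewrite (eq_bigr (fun=> 1)) ?sumr_const // => w _; rewrite dotff0 psi0.
have [h xh] : exists h, x h != 0.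
  by apply/existsP; apply: contraR nx => /existsPn xP; apply/eqP/ffunP => h;
    rewrite ffunE; apply/eqP; have := xP h; rewrite negbK.
have [a taua] := tau_neq0.
have psia : psi a != 1 by rewrite Fp_char_eq1.
pose w0 : V := [ffun k => if k == h then a / x h else 0].
have w0x : dotff w0 x = a.
  rewrite /dotff (bigD1 h) //= ffunE eqxx divfK // big1 ?addr0 // => k /negbTE nk.
  by rewrite ffunE nk mul0r.
apply/eqP; have : (1 - psi a) * \sum_w psi (dotff w x) == 0.
  rewrite mulrBl mul1r subr_eq0 {1}(reindex_inj (addrI w0)) /= big_distrr /=.
  by apply/eqP/eq_bigr => w _; rewrite dotffDl psiD w0x.
by rewrite mulf_eq0 subr_eq0 eq_sym (negbTE psia).
Qed.

Variables (gT : finGroupType) (d : nat) (rG : mx_representation K [set: gT] d).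
Variable e : V -> gT.
Hypothesis eD : forall x y, e (x + y) = (e x * e y)%g.
Hypothesis e_inj : forall x, e x = 1%g -> x = 0.
Hypothesis e_central : forall x g, commute (e x) g.

Let rM g g' : rG (g * g')%g = rG g *m rG g'. Proof. by rewrite repr_mxM ?inE. Qed.

(** The twist by the inverse character turns the average over V into the projection on the component
    where [e x] acts as psi(w . x). *)
Definition char_mx w x : 'M[K]_d := psi (dotff w (- x)) *: rG (e x).

Lemma char_mxD w x y : char_mx w (x + y) = char_mx w x *m char_mx w y.
Proof.
by rewrite /char_mx opprD dotffDr psiD eD rM -scalemxAl -scalemxAr scalerA mulrC.
Qed.

Definition char_proj w := avg_mx (char_mx w).

Lemma psiV w x : psi (dotff w x) * psi (dotff w (- x)) = 1.
Proof. by rewrite -psiD -dotffDr subrr dotff0 psi0. Qed.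

Lemma e0 : e 0 = 1%g.
Proof. by apply: (mulgI (e 0)); rewrite -eD addr0 mulg1. Qed.

Lemma repr_char_proj w x : rG (e x) *m char_proj w = psi (dotff w x) *: char_proj w.
Proof.
have <- : psi (dotff w x) *: char_mx w x = rG (e x).
  by rewrite scalerA psiV scale1r.
by rewrite -scalemxAl (mul_avg_mx addVI (char_mxD w)).
Qed.

(** After exchanging the sums, orthogonality leaves only the term x = 0. *)
Lemma sum_char_proj : \sum_w char_proj w = 1%:M.
Proof.
rewrite /char_proj /avg_mx -scaler_sumr exchange_big /=.
rewrite (bigD1 (0 : V)) //= [X in _ + X]big1 => [|x nx].
  rewrite addr0 -scaler_suml oppr0 sum_psi_dotff eqxx e0 repr_mx1.
  by rewrite scalerA mulVf ?scale1r // (card_neq0 (0 : V)).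
by rewrite -scaler_suml sum_psi_dotff oppr_eq0 (negbTE nx) scale0r.
Qed.

Lemma char_projC w g : rG g *m char_proj w = char_proj w *m rG g.
Proof.
rewrite -scalemxAr -scalemxAl mulmx_sumr mulmx_suml; congr (_ *: _).
apply: eq_bigr => x _; rewrite -scalemxAr -scalemxAl -!rM; congr (_ *: rG _).
exact: esym (e_central x g).
Qed.

(* The trace of rG (y u) on the w-isotypic component vanishes for u <> 0, as y u is conjugate to
   its product by a central element on which w is nontrivial; hence that component is free over
   the image of U. *)
Lemma dvdn_rank_char_proj (U : finZmodType) (y : U -> gT) w :
    (forall u v, y (u + v) = (y u * y v)%g) ->
    (forall u, u != 0 -> exists g z, (y u * g)%g = (g * y u * e z)%g /\ psi (dotff w z) != 1) ->
  (#|U| %| \rank (char_proj w))%N.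
Proof.
move=> yD yJ; pose P := avg_mx (rG \o y).
have PP : P *m P = P.
  by apply: (@avg_mx_idem _ _ _ (fun u v => u + v) _ (@addrI U)) => u v /=; rewrite yD rM.
have EE : char_proj w *m char_proj w = char_proj w := avg_mx_idem addVI (char_mxD w).
have PE : P *m char_proj w = char_proj w *m P.
  rewrite -[LHS]scalemxAl -[RHS]scalemxAr mulmx_sumr mulmx_suml; congr (_ *: _).
  by apply: eq_bigr => u _; exact: char_projC.
have y0 : y 0 = 1%g by apply: (mulgI (y 0)); rewrite -yD addr0 mulg1.
have tr0 u : u != 0 -> \tr (char_proj w *m rG (y u)) = 0.
  move=> /yJ[g [z [yg psiz]]].
  have: \tr (char_proj w *m rG (y u)) = psi (dotff w z) * \tr (char_proj w *m rG (y u)).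
    transitivity (\tr (char_proj w *m rG (g * (y u * e z))%g *m rG g^-1%g)).
      by rewrite -mulmxA -rM mulgA -yg mulgK.
    rewrite mxtrace_mulC mulmxA char_projC -mulmxA -rM mulKg -(e_central z) rM mulmxA.
    by rewrite -(char_projC w (e z)) repr_char_proj -scalemxAl mxtraceZ.
  move/eqP; rewrite -[X in X == _]mul1r -subr_eq0 -mulrBl mulf_eq0 subr_eq0 eq_sym.
  by rewrite (negbTE psiz) => /eqP.
(* The product of the two commuting idempotents is idempotent, so its rank is its trace, to which
   only u = 0 contributes. *)
have: (\rank (char_proj w *m P))%:R * #|U|%:R = (\rank (char_proj w))%:R :> K.
  rewrite -!mxtrace_idem //; last by rewrite mulmxA -(mulmxA _ P) PE mulmxA EE -mulmxA PP.
  rewrite -scalemxAr mxtraceZ mulmx_sumr linear_sum (bigD1 0) //= [X in _ + X]big1 ?addr0.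
    by rewrite y0 repr_mx1 mulmx1 mulrC mulrA divff ?mul1r // (card_neq0 (0 : U)).
  by move=> u nu; exact: tr0.
by move/eqP; rewrite -natrM eqr_nat => /eqP <-; exact: dvdn_mull.
Qed.

Lemma faithful_degree_lower_bound : mx_faithful rG ->
    (forall w, w != 0 -> exists y : F -> gT, (forall u v, y (u + v) = (y u * y v)%g) /\
      forall u, u != 0 -> exists g z, (y u * g)%g = (g * y u * e z)%g /\ psi (dotff w z) != 1) ->
  (#|H| * f * p ^ f <= d)%N.
Proof.
move=> faith yJ; pose S := [set w : V | (w != 0) && (char_proj w != 0)].
have rank_ge w : w \in S -> (p ^ f <= \rank (char_proj w))%N.
  rewrite inE => /andP[/yJ[y [yD yw]] nE].
  rewrite -card_F; apply: dvdn_leq (dvdn_rank_char_proj yD yw).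
  by rewrite lt0n mxrank_eq0.
(* The ranks of the idempotents are their traces, which add up to the trace of the identity. *)
have dE : d = (\sum_w \rank (char_proj w))%N.
  apply/eqP; rewrite -(eqr_nat K) -[X in X == _](mxtrace1 K d) -sum_char_proj.
  rewrite linear_sum natr_sum; apply/eqP/eq_bigr => w _; apply: mxtrace_idem.
  exact: avg_mx_idem addVI (char_mxD w).
have dS : (#|S| * p ^ f <= d)%N.
  rewrite [leqRHS]dE (bigID (mem S)) /= -sum_nat_const.
  by apply: leq_trans (leq_addr _ _); apply: leq_sum.
suff cS : (#|H| * f <= #|S|)%N by apply: leq_trans dS; rewrite leq_mul2r cS orbT.
rewrite leqNgt; apply/negP => ltS.
(* Fewer than [#|H| * f] characters with values in the p-th roots of unity cannot separate the
   points of V; the difference of two points that they confuse would act as the identity. *)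
pose r (x : V) : {ffun 'I_#|S| -> 'F_p} := [ffun i => tau (dotff (enum_val i) x)].
have /injectivePn[x [x' nx rx]] : ~~ injectiveb r.
  apply/injectiveP => /leq_card; rewrite !card_ffun card_F card_Fp // card_ord -expnM.
  by rewrite leq_exp2l ?prime_gt1 // leqNgt mulnC ltS.
case/negP: nx; rewrite -subr_eq0; apply/eqP/e_inj.
apply: (mx_faithful_inj faith); rewrite ?inE // repr_mx1 -[LHS]mulmx1 -sum_char_proj.
rewrite mulmx_sumr; apply: eq_bigr => w _; rewrite repr_char_proj.
have [->|nw] := eqVneq w 0; first by rewrite dot0ff psi0 scale1r.
have [->|nE] := eqVneq (char_proj w) 0; first by rewrite scaler0.
have wS : w \in S by rewrite inE nw.
have /ffunP/(_ (enum_rank_in wS w)) := rx; rewrite !ffunE enum_rankK_in // => tauE.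
rewrite [psi _](_ : _ = 1) ?scale1r // -psi0 /psi; congr Fp_char.
by rewrite dotffDr raddfD tauE -raddfD -dotffDr subrr dotff0.
Qed.

End LowerBound.

(** * Monomial representations and characters of F_q *)

Section MonomialRepresentation.
Variables (K : fieldType) (gT : finGroupType) (T : finType) (s : gT -> T -> T) (c : gT -> T -> K).
Hypotheses (s1 : forall t, s 1%g t = t) (sM : forall g h t, s (g * h)%g t = s h (s g t)).
Hypotheses (c1 : forall t, c 1%g t = 1) (cM : forall g h t, c (g * h)%g t = c g t * c h (s g t)).

(** Matrices act on row vectors, so [s] is a right action and [c] a multiplicative cocycle for
    it. *)
Definition monomial_mx g : 'M[K]_#|T| :=
  \matrix_(i, j) (c g (enum_val i) *+ (s g (enum_val i) == enum_val j)).

Lemma monomial_mx_repr : mx_repr [set: gT] monomial_mx.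
Proof.
split=> [|g h _ _]; apply/matrixP => i j; rewrite !mxE.
  by rewrite s1 c1 (inj_eq enum_val_inj).
rewrite (bigD1 (enum_rank (s g (enum_val i)))) //= !mxE enum_rankK eqxx mulr1n.
rewrite sM cM big1 ?addr0 ?mulrnAr // => k nk; rewrite !mxE.
case: eqP => [E|_]; last by rewrite mul0r.
by move: nk; rewrite E enum_valK eqxx.
Qed.

Definition monomial_repr := MxRepresentation monomial_mx_repr.

(** A diagonal entry is 0 if g moves the point and [c g t] otherwise, so the diagonal already
    detects the kernel. *)
Lemma monomial_faithful : (forall g, (forall t, s g t = t /\ c g t = 1) -> g = 1%g) ->
  mx_faithful monomial_repr.
Proof.
move=> faith; apply/subsetP => g /rkerP[_ /matrixP M1]; rewrite inE; apply/eqP/faith => t.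
have := M1 (enum_rank t) (enum_rank t); rewrite !mxE enum_rankK eqxx.
case: eqP => [st|_]; first by rewrite mulr1n.
by rewrite mulr0n => /eqP; rewrite eq_sym oner_eq0.
Qed.

End MonomialRepresentation.

(** Take a root of 1 + X + ... + X^(p-1); the value of this polynomial at 1 is p, which is nonzero
    in characteristic 0. *)
Lemma prime_unity_root (K : numClosedFieldType) p : prime p ->
  exists2 zeta : K, zeta ^+ p = 1 & zeta != 1.
Proof.
move=> p_pr; have p_gt1 := prime_gt1 p_pr.
pose P : {poly K} := \poly_(i < p) 1.
have sP : size P = p by rewrite size_poly_eq ?oner_eq0.
have /closed_rootP[z /rootP Pz] : size P != 1 by rewrite sP gtn_eqF.
have sumz : \sum_(i < p) z ^+ i = 0.
  by rewrite -[RHS]Pz horner_poly; apply: eq_bigr => i _; rewrite mul1r.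
exists z; first by apply/eqP; rewrite -subr_eq0 subrX1 sumz mulr0.
apply/eqP => z1; move/eqP: sumz; rewrite z1 (eq_bigr (fun=> 1)) => [|i _]; last by rewrite expr1n.
by rewrite sumr_const card_ord pnatr_eq0 gtn_eqF // ltnW.
Qed.

(** These are the coordinates in a basis of F over its prime field, where F has dimension f. *)
Lemma Fp_coordinates (F : finFieldType) p f : prime p -> #|F| = (p ^ f)%N ->
  exists tau : 'I_f -> {additive F -> 'F_p}, forall x, (forall i, tau i x = 0) -> x = 0.
Proof.
move=> p_pr cF; have chF := card_finPcharP cF p_pr.
have [v v_lin v_bij] := pprimeChar_vectAxiom chF.
have vB : zmod_morphism (v : F -> _).
  move=> x y; transitivity (v (-1 *: (y : pPrimeCharType chF) + x)).
    by congr v; rewrite scaleN1r; exact: addrC.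
  by rewrite v_lin scaleN1r; exact: addrC.
have En : logn p #|F| = f by rewrite cF pfactorK.
have tauB i : zmod_morphism (fun x : F => v x 0 (cast_ord (esym En) i)).
  by move=> x y; rewrite vB !mxE.
pose tau i : {additive F -> 'F_p} :=
  HB.pack (fun x : F => v x 0 (cast_ord (esym En) i)) (GRing.isZmodMorphism.Build _ _ _ (tauB i)).
exists tau => x tau0; apply: (bij_inj v_bij); apply/rowP => i.
have v0 : v (0 : F) = 0 by rewrite -(subrr (0 : F)) vB subrr.
rewrite v0 mxE.
by have := tau0 (cast_ord En i); rewrite /= cast_ordK.
Qed.

(** * Morphisms to the filiform Lie algebra *)

(* A tuple (a, y, w, z) stands for a X + y Y + w W + z Z, where [X, Y] = eps W, [X, W] = Z and the
   other brackets of basis vectors vanish. *)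
Definition filiform (F : fieldType) (eps : F) : Type := (F * F * F * F)%type.

Section Filiform.
Variables (F : fieldType) (eps : F).
Local Notation L := (filiform eps).

HB.instance Definition _ := GRing.Zmodule.on L.

Definition coX (u : L) : F := u.1.1.1.
Definition coY (u : L) : F := u.1.1.2.
Definition coW (u : L) : F := u.1.2.
Definition coZ (u : L) : F := u.2.

Arguments coX : simpl never.
Arguments coY : simpl never.
Arguments coW : simpl never.
Arguments coZ : simpl never.

Lemma filiform_ext u v : coX u = coX v -> coY u = coY v -> coW u = coW v -> coZ u = coZ v -> u = v.
Proof.
by case: u v => [[[a y] w] z] [[[a' y'] w'] z']; rewrite /coX /coY /coW /coZ /= => -> -> -> ->.
Qed.

HB.instance Definition _ := GRing.isZmodMorphism.Build L F coX (fun _ _ => erefl).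
HB.instance Definition _ := GRing.isZmodMorphism.Build L F coY (fun _ _ => erefl).
HB.instance Definition _ := GRing.isZmodMorphism.Build L F coW (fun _ _ => erefl).
HB.instance Definition _ := GRing.isZmodMorphism.Build L F coZ (fun _ _ => erefl).

Definition filiform_lie (u v : L) : L :=
  (0, 0, eps * (coX u * coY v - coX v * coY u), coX u * coW v - coX v * coW u).

Fact coX_lie u v : coX (filiform_lie u v) = 0. Proof. by []. Qed.
Fact coY_lie u v : coY (filiform_lie u v) = 0. Proof. by []. Qed.
Fact coW_lie u v : coW (filiform_lie u v) = eps * (coX u * coY v - coX v * coY u).
Proof. by []. Qed.
Fact coZ_lie u v : coZ (filiform_lie u v) = coX u * coW v - coX v * coW u.
Proof. by []. Qed.
Definition co_lie := (coX_lie, coY_lie, coW_lie, coZ_lie).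

Fact filiform_lieDl : left_distributive filiform_lie +%R.
Proof. by move=> u v t; apply: filiform_ext; rewrite !raddfD /= ?co_lie ?raddfD /=; ring. Qed.
Fact filiform_lieDr : right_distributive filiform_lie +%R.
Proof. by move=> u v t; apply: filiform_ext; rewrite !raddfD /= ?co_lie ?raddfD /=; ring. Qed.
Fact filiform_liexx u : filiform_lie u u = 0.
Proof. by apply: filiform_ext; rewrite ?co_lie !raddf0 /=; ring. Qed.
Fact filiform_jacobi u v t : filiform_lie u (filiform_lie v t) + filiform_lie v (filiform_lie t u) +
  filiform_lie t (filiform_lie u v) = 0.
Proof. by apply: filiform_ext; rewrite !raddfD !raddf0 /= ?co_lie; ring. Qed.

HB.instance Definition _ := Zmodule_isLieRing.Build L
  filiform_lieDl filiform_lieDr filiform_liexx filiform_jacobi.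

Lemma filiform_lcs2 u : lcs L 2 u -> coX u = 0 /\ (eps = 0 -> coW u = 0).
Proof.
elim=> [|_ [v [t [_ ->]]]|v t _ [a w] _ [a' w']]; first by rewrite !raddf0.
  by rewrite !co_lie; split=> // ->; rewrite mul0r.
by rewrite !raddfB /= a a' subrr; split=> // e0; rewrite w // w' // subrr.
Qed.

Lemma filiform_lcs3 u : lcs L 3 u -> [/\ coX u = 0, coY u = 0, coW u = 0 & eps = 0 -> coZ u = 0].
Proof.
elim=> [|_ [v [t [lt ->]]]|v t _ [a y w z] _ [a' y' w' z']]; first by rewrite !raddf0.
  have [a w] := filiform_lcs2 lt.
  have y : coY t = 0.
    by elim: lt => [|_ [? [? [_ ->]]]|s s' _ s0 _ s0'] //=; rewrite raddfB /= s0 s0' subrr.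
  by rewrite !co_lie a y !(mul0r, mulr0, subr0); split=> // /w ->; rewrite mulr0.
by rewrite !raddfB /= a a' y y' w w' subrr; split=> // e0; rewrite z // z' // subrr.
Qed.

(** For eps = 0 the only bracket left is [X, W] = Z, which lowers the class from 3 to 2. *)
Lemma filiform_nilpotent c u : c = 3%N \/ c = 2%N /\ eps = 0 -> lcs L c.+1 u ->
  [/\ coX u = 0, coY u = 0, coW u = 0 & coZ u = 0].
Proof.
case=> [->|[-> e0]]; last by move/filiform_lcs3 => [-> -> -> ->].
elim=> [|_ [v [t [lt ->]]]|v t _ [a y w z] _ [a' y' w' z']]; first by rewrite !raddf0.
  by have [a y w _] := filiform_lcs3 lt; rewrite !co_lie a y w !(mul0r, mulr0, subr0).
by rewrite !raddfB /= a a' y y' w w' z z' subrr.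
Qed.

(** The scalars through which the tensor factor F acts in [filiform_hom]. *)
Definition filiform_scale (k : F) (u : L) : L := (k * coX u, k * coY u, k * coW u, k * coZ u).

Lemma coX_scale k u : coX (filiform_scale k u) = k * coX u. Proof. by []. Qed.
Lemma coY_scale k u : coY (filiform_scale k u) = k * coY u. Proof. by []. Qed.
Lemma coW_scale k u : coW (filiform_scale k u) = k * coW u. Proof. by []. Qed.
Lemma coZ_scale k u : coZ (filiform_scale k u) = k * coZ u. Proof. by []. Qed.
Definition co_scale := (coX_scale, coY_scale, coW_scale, coZ_scale).

End Filiform.
Arguments coX : simpl never.
Arguments coY : simpl never.
Arguments coW : simpl never.
Arguments coZ : simpl never.


Lemma lcs_free_lift n (L : lieRingType) (g : 'I_n -> L) k u :
  lcs (free_lie n) k u -> lcs L k (free_lift g u).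
Proof.
have lift0 : free_lift g 0 = 0 :> L by exact: free_lift0.
elim: k u => [|[|k] IH] u //; elim=> [|_ [v [t [lt ->]]]|v t _ lv _ lt].
- by rewrite lift0; exact: lcs0.
- have -> : free_lift g ⟦v, t⟧ = ⟦free_lift g v, free_lift g t⟧ by exact: free_liftL.
  exact/lcsS/IH.
- have -> : free_lift g (v - t) = free_lift g v - free_lift g t.
    by rewrite -free_liftN -free_liftD.
  exact: lcsB.
Qed.

Section FiliformHom.
Variables (F : fieldType) (eps : F) (n c : nat) (alpha gamma delta : 'I_n -> F).
Hypothesis nil : c = 3%N \/ c = 2%N /\ eps = 0.
Local Notation L := (free_nil_tensor n c F).

Definition filiform_gen l : filiform eps := (alpha l, gamma l, delta l, 0).

Definition filiform_nil (q : free_nil_lie n c) : filiform eps :=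
  free_lift filiform_gen (nil_repr q).

(** Two representatives differ by an element of the (c+1)-st term of the lower central series, whose
    image in the filiform algebra vanishes by nilpotency. *)
Lemma filiform_nil_pi u : filiform_nil (nil_pi c u) = free_lift filiform_gen u.
Proof.
set v := nil_repr (nil_pi c u).
have /nil_pi_eq/(lcs_free_lift filiform_gen)/(filiform_nilpotent nil) :
  nil_pi c v = nil_pi c u by rewrite nil_reprK.
have -> : free_lift filiform_gen (v - u) = free_lift filiform_gen v - free_lift filiform_gen u.
  by rewrite -free_liftN -free_liftD.
by rewrite !raddfB => -[] /= /subr0_eq a /subr0_eq y /subr0_eq w /subr0_eq z; apply: filiform_ext.
Qed.

Lemma filiform_nilD : {morph filiform_nil : q q' / q + q'}.
Proof.
move=> q q'; have [[u ->] [v ->]] := (nil_pi_surj q, nil_pi_surj q').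
by rewrite -raddfD !filiform_nil_pi -free_liftD.
Qed.

Definition filiform_hom (t : L) : filiform eps :=
  tens_lift (fun q a => filiform_scale a (filiform_nil q)) t.

Fact filiform_hom_biadditive : biadditive (fun q a => filiform_scale a (filiform_nil q)).
Proof.
split=> [a q q'|q a a']; rewrite ?filiform_nilD; apply: filiform_ext;
by rewrite [RHS]raddfD /= !co_scale ?raddfD /= ?mulrDl ?mulrDr.
Qed.

Lemma filiform_hom_pure u a :
  filiform_hom (pure_tens (nil_pi c u) a) = filiform_scale a (free_lift filiform_gen u).
Proof.
by rewrite /filiform_hom tens_lift_pure ?filiform_nil_pi //; exact: filiform_hom_biadditive.
Qed.

Fact filiform_homB : zmod_morphism filiform_hom.
Proof.
have bb := filiform_hom_biadditive.
by move=> t t'; rewrite /filiform_hom -tens_liftN // -tens_liftD.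
Qed.
HB.instance Definition _ := GRing.isZmodMorphism.Build L (filiform eps) filiform_hom filiform_homB.

Lemma filiform_hom_lie t t' : filiform_hom ⟦t, t'⟧ = ⟦filiform_hom t, filiform_hom t'⟧.
Proof.
move: t; apply: tens_ind => [|q a t IHt]; first by rewrite lie0l !raddf0 lie0l.
rewrite lieDl !raddfD /= lieDl IHt; congr (_ + _).
move: t' {IHt t}; apply: tens_ind => [|q' a' t IHt]; first by rewrite lie0r !raddf0 lie0r.
rewrite lieDr !raddfD /= lieDr IHt; congr (_ + _).
have [[u ->] [v ->]] := (nil_pi_surj q, nil_pi_surj q').
have -> : ⟦pure_tens (nil_pi c u) a, pure_tens (nil_pi c v) a'⟧ =
  pure_tens (nil_pi c ⟦u, v⟧) (a * a') :> L by rewrite nil_pi_lie; exact: tens_lie_pure.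
rewrite !filiform_hom_pure.
have -> : free_lift filiform_gen ⟦u, v⟧ = ⟦free_lift filiform_gen u, free_lift filiform_gen v⟧.
  exact: free_liftL.
by apply: filiform_ext; rewrite !co_scale !co_lie ?co_scale; ring.
Qed.

End FiliformHom.

(** * Representations of the group of the filiform Lie algebra *)

Section FiliformCocycle.
Variables (F : fieldType) (eps : F).
Hypotheses (two_neq0 : 2 != 0 :> F) (eps3 : eps = 0 \/ 3 != 0 :> F).

(* The coordinate of Z in exp(s ad X) v, where exp(u) = exp(v) exp(a X) and a = coX u. *)
Definition cocycle (u : filiform eps) (s : F) : F :=
  coZ u + (s + coX u / 2) * coW u + eps * (s ^+ 2 / 2 + s * coX u / 2 + coX u ^+ 2 / 6) * coY u.

(** The hypotheses are the BCH formula for t = u * v in coordinates, where the cubic terms survive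
    only along Z. The conclusion makes translation by [coX], combined with a character of the
    cocycle, a group action. *)
Lemma cocycleM (u v t : filiform eps) s :
  coX t = coX u + coX v -> coY t = coY u + coY v ->
  coW t = coW u + coW v + coW ⟦u, v⟧ / 2 ->
  coZ t = coZ u + coZ v + coZ ⟦u, v⟧ / 2 + coZ ⟦u, ⟦u, v⟧⟧ / 12 + coZ ⟦v, ⟦v, u⟧⟧ / 12 ->
  cocycle t s = cocycle u s + cocycle v (s + coX u).
Proof.
rewrite !co_lie /cocycle => -> -> -> ->.
(* For p = 3, the denominators 6 and 12 occur only in terms that eps = 0 kills. *)
case: eps3 => [e0|three_neq0].
  rewrite e0 !(mul0r, mulr0, subr0, addr0). by field; rewrite ?two_neq0.
have six_neq0 : 6 != 0 :> F by rewrite (natrM _ 2 3) mulf_neq0.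
have twelve_neq0 : 12 != 0 :> F by rewrite (natrM _ 2 6) mulf_neq0.
by field; rewrite six_neq0 two_neq0 twelve_neq0.
Qed.

Lemma cocycle0 s : cocycle 0 s = 0.
Proof. by rewrite /cocycle !raddf0 /= !mulr0 !addr0. Qed.

(** For [coX u = 0] the cocycle is the polynomial Z + s W + eps s^2 Y / 2 in s, and its values at 0,
    1 and -1 determine the coefficients. *)
Lemma cocycle_eq0 (u : filiform eps) : coX u = 0 -> (forall s, cocycle u s = 0) ->
  [/\ coW u = 0, coZ u = 0 & eps = 0 \/ coY u = 0].
Proof.
move=> a0 u0; have z0 : coZ u = 0.
  by have := u0 0; rewrite /cocycle a0 !(mul0r, addr0, mulr0, expr0n).
have w0 : coW u = 0.
  apply: (mulfI two_neq0); transitivity (cocycle u 1 - cocycle u (-1)).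
    by rewrite /cocycle a0 z0 !(mul0r, mulr0, addr0, add0r, expr0n) /=; field.
  by rewrite !u0 subrr mulr0.
split=> //; have := u0 1.
rewrite /cocycle a0 w0 z0 !(mulr0, mul0r, addr0, add0r, expr0n) expr1n mul1r.
move/eqP; rewrite !mulf_eq0 invr_eq0 (negbTE two_neq0) orbF => /orP[] /eqP; by [left|right].
Qed.

End FiliformCocycle.

(** This turns [lie_divn], a multiple by an inverse of m modulo the order of L, into a division in
    F. If m = 0 in F, then x = 0 and both sides vanish. *)
Lemma mulrn_divr (F : fieldType) (x : F) m k : x *+ (m * k) = x -> x *+ k = x / m%:R.
Proof.
have [m0|nm] := eqVneq (m%:R : F) 0; last first.
  by move=> E; rewrite -{2}E -(mulr_natr _ (m * k)) natrM mulrA mulrAC mulfK // mulr_natr.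
by rewrite -(mulr_natl x (m * k)) natrM m0 !mul0r => <-; rewrite mul0rn mul0r.
Qed.

Section ExpLie.
Variables (L : finLieRingType).
Hypothesis lazL : lazard_lie L.
Implicit Types x y : exp_lie L.

Lemma exp_lieM_comm x y : ⟦x : L, y⟧ = 0 -> (x * y)%g = (x : L) + y.
Proof.
move=> xy0; have yx0 : ⟦y : L, x⟧ = 0 by rewrite lieC xy0 oppr0.
by rewrite exp_lieM // /bch /lie_divn xy0 yx0 !lie0r !mul0rn !addr0.
Qed.

Lemma exp_lie_comm x y : ⟦x : L, y⟧ = 0 -> commute x y.
Proof.
move=> xy0; have yx0 : ⟦y : L, x⟧ = 0 by rewrite lieC xy0 oppr0.
by rewrite /commute !exp_lieM_comm // addrC.
Qed.

(** By BCH, the two products differ by [y, x]/2 - [x, y]/2 = [y, x]. *)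
Lemma exp_lie_commutator x y : (forall z : L, ⟦z, ⟦x : L, y⟧⟧ = 0) ->
  (y * x)%g = (x * y * (⟦y : L, x⟧ : exp_lie L))%g.
Proof.
move=> cxy; have [l2 _ _] := lazard_lie_bounds lazL.
have cyx (z : L) : ⟦z, ⟦y : L, x⟧⟧ = 0 by rewrite (lieC (y : L)) lieNr cxy oppr0.
rewrite [RHS]exp_lieM_comm ?cyx // !exp_lieM // /bch /lie_divn !cxy !cyx !mul0rn !addr0.
rewrite (addrC (y : L)) -!addrA; congr (_ + (_ + _)).
by rewrite -[X in _ = _ + X]l2 mul2n -addnn mulrnDr addrA (lieC (x : L)) mulNrn addNr add0r.
Qed.

End ExpLie.

(** * Faithful dimension from a family of filiform morphisms *)

Section FaithfulDegree.
Variables (R : realType) (F : finFieldType) (p f n c : nat) (eps : F) (H : finType).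
Variables (alpha gamma delta : H -> 'I_n -> F) (hd : H -> 'I_n) (tl : H -> free_lie n).
Hypotheses (p_prime : prime p) (card_F : #|F| = (p ^ f)%N) (lt_cp : (c < p)%N).
Hypotheses (p_gt2 : (2 < p)%N) (nil : c = 3%N \/ c = 2%N /\ eps = 0).

Local Notation L := (free_nil_tensor n c F).
Local Notation gen h := (filiform_gen eps (alpha h) (gamma h) (delta h)).
Local Notation hom h := (@filiform_hom _ eps n c (alpha h) (gamma h) (delta h)).
Local Notation top h := ⟦flie_gen (hd h), tl h⟧.

(** [top_lcs] makes the top brackets central and [top_inj] makes them independent, for the lower
    bound. [hom_inj] gives faithfulness in the upper bound; Y acts through eps, hence the
    disjunction in it. *)
Hypothesis top_lcs : forall h, lcs (free_lie n) c (top h).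
Hypothesis top_inj : forall x : {ffun H -> F},
  (forall h, \sum_k x k * coZ (free_lift (gen h) (top k)) = 0) -> x = 0.
Hypothesis hom_inj : forall u : L,
  (forall h, [/\ coX (hom h u) = 0, coW (hom h u) = 0, coZ (hom h u) = 0 &
     eps = 0 \/ coY (hom h u) = 0]) -> u = 0.

Let chF : p \in [pchar F]. Proof. exact: card_finPcharP card_F p_prime. Qed.

Let small_neq0 m : (0 < m < p)%N -> m%:R != 0 :> F.
Proof. by case/andP=> m_gt0 ltmp; rewrite -(dvdn_pcharf chF) gtnNdvd. Qed.

Let two_neq0 : 2 != 0 :> F. Proof. exact: small_neq0. Qed.

Let eps3 : eps = 0 \/ 3 != 0 :> F.
Proof. by case: nil lt_cp => [-> lt3p|[_ ->] _]; [right; apply: small_neq0 | left]. Qed.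

Let c_le3 : (c <= 3)%N. Proof. by case: nil => [->|[->]]. Qed.

Let lazL : lazard_lie L. Proof. exact: free_nil_lazard p_prime card_F lt_cp c_le3. Qed.

Let ex_tau : exists tau : 'I_f -> {additive F -> 'F_p}, forall x, (forall i, tau i x = 0) -> x = 0.
Proof. exact: Fp_coordinates. Qed.

(** The morphism carries the BCH product of L to the one in coordinates, with 1/2 and 1/12 becoming
    divisions in F; then [cocycleM] applies. *)
Lemma filiform_hom_mulg h (u v : exp_lie L) s :
  coX (hom h (u * v)%g) = coX (hom h u) + coX (hom h v) /\
  cocycle (hom h (u * v)%g) s = cocycle (hom h u) s + cocycle (hom h v) (s + coX (hom h u)).
Proof.
have [l2 l3 _] := lazard_lie_bounds lazL.
have lie_hom := filiform_hom_lie (alpha h) (gamma h) (delta h) nil.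
have E2 x y (k : {additive filiform eps -> F}) :
    k (hom h (lie_divn ⟦x : L, y⟧ 2)) = k ⟦hom h x, hom h y⟧ / 2.
  rewrite /lie_divn -lie_hom; set t := ⟦x, y⟧.
  rewrite !raddfMn; apply: mulrn_divr; rewrite -!raddfMn; congr (k (hom h _)); exact: l2.
have E3 x y z (k : {additive filiform eps -> F}) :
    k (hom h (lie_divn ⟦x : L, ⟦y, z⟧⟧ 12)) = k ⟦hom h x, ⟦hom h y, hom h z⟧⟧ / 12.
  rewrite /lie_divn -!lie_hom; set t := ⟦x, _⟧.
  rewrite !raddfMn; apply: mulrn_divr; rewrite -!raddfMn; congr (k (hom h _)); exact: l3.
have homE : hom h (u * v)%g = hom h (bch (u : L) v) by rewrite exp_lieM.
have kE (k : {additive filiform eps -> F}) : k (hom h (u * v)%g) =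
    k (hom h u) + k (hom h v) + k ⟦hom h u, hom h v⟧ / 2 +
    k ⟦hom h u, ⟦hom h u, hom h v⟧⟧ / 12 + k ⟦hom h v, ⟦hom h v, hom h u⟧⟧ / 12.
  by rewrite homE /bch !raddfD; rewrite E2 !E3.
have XE := kE (@coX F eps); have YE := kE (@coY F eps).
have WE := kE (@coW F eps); have ZE := kE (@coZ F eps).
move: XE YE WE ZE; rewrite /= !co_lie !(mul0r, mulr0, subr0, addr0) => XE YE WE ZE.
by split=> //; apply: cocycleM; rewrite ?co_lie.
Qed.

Lemma has_faithful_repr_free_nil : has_faithful_repr R [set: exp_lie L] (#|H| * f * p ^ f).
Proof.
have [zeta zetaX zeta1] := @prime_unity_root R[i] p p_prime.
have [tau tau_inj] := ex_tau.
(* A basis of the sum of the representations: a basis vector h of L^c, a character i and a point of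
   F. *)
pose T := (H * 'I_f * F)%type.
pose s (u : exp_lie L) (t : T) : T := (t.1, t.2 + coX (hom t.1.1 u)).
pose k (u : exp_lie L) (t : T) : R[i] := Fp_char zeta (tau t.1.2 (cocycle (hom t.1.1 u) t.2)).
have hom1 h : hom h (1%g : exp_lie L) = 0 by exact: (raddf0 (hom h)).
have s1 t : s 1%g t = t by case: t => [[h i] a]; rewrite /s /= hom1 raddf0 addr0.
have sM u v t : s (u * v)%g t = s v (s u t).
  by rewrite /s /= (filiform_hom_mulg t.1.1 u v 0).1 addrA.
have k1 t : k 1%g t = 1 by rewrite /k hom1 cocycle0 raddf0 Fp_char0.
have kM u v t : k (u * v)%g t = k u t * k v (s u t).
  by rewrite /k (filiform_hom_mulg _ u v _).2 raddfD Fp_charD.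
have -> : (#|H| * f * p ^ f)%N = #|{: T}| by rewrite !card_prod card_ord card_F.
exists (monomial_repr s1 sM k1 kM); apply: monomial_faithful => u su.
apply: hom_inj => h.
(* Some character index is needed to read off the translation [coX]. *)
have f_gt0 : (0 < f)%N.
  by rewrite lt0n; apply/eqP => f0; have := finRing_gt1 F; rewrite card_F f0.
have X0 : coX (hom h u) = 0.
  have [[]] := su (h, Ordinal f_gt0, 0); by rewrite /= add0r.
have u0 a : cocycle (hom h u) a = 0.
  apply: tau_inj => i; have [_ /eqP] := su (h, i, a).
  by rewrite /k Fp_char_eq1 // => /eqP.
have [W0 Z0 Y0] := cocycle_eq0 two_neq0 X0 u0.
by split.
Qed.

Lemma faithful_repr_free_nil_ge d : has_faithful_repr R [set: exp_lie L] d ->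
  (#|H| * f * p ^ f <= d)%N.
Proof.
case=> rG faith.
have [zeta zetaX zeta1] := @prime_unity_root R[i] p p_prime.
have [tau tau_inj] := ex_tau.
have [i [b tau_b]] : exists i b, tau i b != 0.
  have [/existsP[i /existsP[b]]|/existsPn tau0] := boolP [exists i, [exists b, tau i b != 0]].
    by exists i, b.
  have /eqP := oner_neq0 F; case; apply: tau_inj => i.
  by have /existsPn/(_ 1) := tau0 i; rewrite negbK => /eqP.
have [pDl pDr] := pure_tens_biadditive (free_nil_lie n c) F.
pose e (x : {ffun H -> F}) : L := \sum_h pure_tens (nil_pi c (top h)) (x h).
have eD x y : e (x + y) = e x + e y.
  by rewrite -big_split; apply: eq_bigr => h _; rewrite ffunE pDr.
have pure_central h a (u : L) : ⟦u, pure_tens (nil_pi c (top h)) a⟧ = 0.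
  move: u; apply: tens_ind => [|q b' u IH]; first by rewrite lie0l.
  rewrite lieDl IH addr0; have [v ->] := nil_pi_surj q.
  have -> : ⟦pure_tens (nil_pi c v) b', pure_tens (nil_pi c (top h)) a⟧ =
    pure_tens (nil_pi c ⟦v, top h⟧) (b' * a) :> L.
    by rewrite [nil_pi c ⟦v, _⟧]nil_pi_lie; exact: tens_lie_pure.
  have -> : nil_pi c ⟦v, top h⟧ = 0.
    by rewrite -(raddf0 (nil_pi c)); apply/nil_pi_eq; rewrite subr0; apply/lcsS/top_lcs.
  exact: pure_tens0l.
have e_central x (u : L) : ⟦u, e x⟧ = 0.
  by rewrite lie_sumr big1 // => h _; exact: pure_central.
apply: (@faithful_degree_lower_bound _ F p f zeta (tau i) p_prime zetaX zeta1 _ card_F H _ _ rG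
  (e : _ -> exp_lie L)) => //.
- by exists b.
- by move=> x y; rewrite exp_lieM_comm // eD.
- move=> x ex0; apply: top_inj => h.
  have : coZ (hom h (e x)) = 0 by rewrite [e x]ex0 !raddf0.
  rewrite /e (raddf_sum (hom h)) (raddf_sum (@coZ F eps)) /=.
  rewrite (eq_bigr (fun k => x k * coZ (free_lift (gen h) (top k)))) // => k _.
  by rewrite filiform_hom_pure.
- by move=> x g; apply: commute_sym; apply: exp_lie_comm.
move=> w nw; have [h wh] : exists h, w h != 0.
  apply/existsP; apply: contraR nw => /existsPn xP; apply/eqP/ffunP => h.
  by rewrite ffunE; apply/eqP; have := xP h; rewrite negbK.
pose y a : L := pure_tens (nil_pi c (tl h)) a.
exists y; split=> [a a'|a na].
  rewrite exp_lieM_comm ?[y _]pDr //.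
  have -> : ⟦y a, y a'⟧ = pure_tens (nil_pi c ⟦tl h, tl h⟧) (a * a').
    by rewrite nil_pi_lie; exact: tens_lie_pure.
  by rewrite liexx raddf0 pure_tens0l.
(* This k makes [y a, g] = e z with w . z = w h * a * k = b, a point where [tau i] is nonzero. *)
pose k := b / (w h * a).
pose g : L := pure_tens (nil_pi c (flie_gen (hd h))) (- k).
pose z : {ffun H -> F} := [ffun l => if l == h then a * k else 0].
have ez : e z = pure_tens (nil_pi c (top h)) (a * k).
  rewrite /e (bigD1 h) //= ffunE eqxx big1 ?addr0 // => l /negbTE nl.
  by rewrite ffunE nl; apply: biadd0r; exact: pure_tens_biadditive.
have gy : ⟦g, y a⟧ = pure_tens (nil_pi c (top h)) (- (a * k)).
  by rewrite -mulNr mulrC mulrN -mulNr mulrC [a * _]mulrC nil_pi_lie; exact: tens_lie_pure.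
exists g, z; split.
  have -> : (e z : exp_lie L) = ⟦y a, g⟧ :> L.
    rewrite lieC gy ez; apply: (addrI (pure_tens (nil_pi c (top h)) (- (a * k)))).
    by rewrite -pDr addNr subrr; apply: biadd0r; exact: pure_tens_biadditive.
  by apply: exp_lie_commutator => // v; rewrite gy.
rewrite Fp_char_eq1 // (_ : dotff w z = b) //.
rewrite /dotff (bigD1 h) //= ffunE eqxx big1 ?addr0 => [|l /negbTE nl].
  by rewrite /k mulrA mulrC divfK // mulf_neq0.
by rewrite ffunE nl mulr0.
Qed.

Lemma m_faithful_free_nil : m_faithful R [set: exp_lie L] = (#|H| * f * p ^ f)%N.
Proof.
have [has_m min_m] := m_faithfulP R [set: exp_lie L].
apply/eqP; rewrite eqn_leq min_m ?faithful_repr_free_nil_ge //.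
exact: has_faithful_repr_free_nil.
Qed.

End FaithfulDegree.

(** * Hall bases in degrees 2 and 3 *)

Section HallBasis.
Variable n : nat.

Definition hall2 : Type := {t : 'I_n * 'I_n | (t.1 < t.2)%N}.
Definition hall3 : Type := {t : 'I_n * ('I_n * 'I_n) | (t.2.1 < t.2.2)%N && (t.2.1 <= t.1)%N}.
HB.instance Definition _ := Finite.on hall2.
HB.instance Definition _ := Finite.on hall3.

Lemma sum_ltn m i : (\sum_(j < m) (i < j) = m - i.+1)%N.
Proof. by elim: m => [|m IH]; rewrite ?big_ord0 // big_ord_recr /= IH; lia. Qed.

Lemma sum_leqn m i : (\sum_(j < m) (i <= j) = m - i)%N.
Proof. by elim: m => [|m IH]; rewrite ?big_ord0 // big_ord_recr /= IH; lia. Qed.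

Lemma card_hall2 : #|{: hall2}| = ((n ^ 2 - n) %/ 2)%N.
Proof.
rewrite card_sig -sum1_card big_mkcond /=.
rewrite -(pair_big predT predT (fun i j : 'I_n => if (i < j)%N then 1%N else 0%N)) /=.
have E m : ((\sum_(i < m) (m - i.+1)) * 2 = m ^ 2 - m)%N.
  elim: m => [|m IH]; first by rewrite big_ord0.
  by rewrite big_ord_recl /= mulnDl (eq_bigr (fun i : 'I_m => m - i.+1)%N) // IH; nia.
rewrite -(E n) mulnK //; apply: eq_bigr => i _.
by rewrite -sum_ltn; apply: eq_bigr => j _; case: (i < j)%N.
Qed.

(** For a fixed middle letter j there are n - j - 1 choices of the last letter and n - j of the
    first one. *)
Lemma card_hall3 : #|{: hall3}| = ((n ^ 3 - n) %/ 3)%N.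
Proof.
rewrite card_sig -sum1_card big_mkcond /=.
rewrite -(pair_big predT predT
  (fun (i : 'I_n) (t : 'I_n * 'I_n) => if (t.1 < t.2)%N && (t.1 <= i)%N then 1%N else 0%N)) /=.
have E m : ((\sum_(j < m) (m - j.+1) * (m - j)) * 3 = m ^ 3 - m)%N.
  elim: m => [|m IH]; first by rewrite big_ord0.
  rewrite big_ord_recl /= mulnDl (eq_bigr (fun j : 'I_m => (m - j.+1) * (m - j))%N) // IH.
  (* This keeps the truncated subtraction in m^3 - m exact. *)
  have : (m <= m ^ 3)%N by case: m {IH} => // m; rewrite -{1}(expn1 m.+1) leq_pexp2l.
  by rewrite !expnS; nia.
rewrite -(E n) mulnK //.
transitivity (\sum_(i < n) \sum_(j < n) \sum_(k < n) (j < k) * (j <= i))%N.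
  apply: eq_bigr => i _; rewrite pair_big /=; apply: eq_bigr => t _.
  by case: (t.1 < t.2)%N; case: (t.1 <= i)%N.
rewrite exchange_big /=; apply: eq_bigr => j _.
rewrite -sum_ltn -sum_leqn big_distrr /=; apply: eq_bigr => i _; by rewrite big_distrl.
Qed.

Variables (c : nat) (F : finFieldType).
Hypothesis c_le3 : (c <= 3)%N.
Local Notation L := (free_nil_tensor n c F).
Local Notation pure x a := (pure_tens (nil_pi c x) a : L).
Local Notation e := (@flie_gen n).

Definition hall_elt2 (h : hall2) : free_lie n := ⟦e (val h).1, e (val h).2⟧.
Definition hall_elt3 (h : hall3) : free_lie n := ⟦e (val h).1, ⟦e (val h).2.1, e (val h).2.2⟧⟧.

Definition hall_comb (a : {ffun 'I_n -> F}) (b : {ffun hall2 -> F}) (d : {ffun hall3 -> F}) : L :=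
  \sum_i pure (e i) (a i) + \sum_h pure (hall_elt2 h) (b h) + \sum_h pure (hall_elt3 h) (d h).

Let pureDl := (pure_tens_biadditive (free_nil_lie n c) F).1.
Let pureDr := (pure_tens_biadditive (free_nil_lie n c) F).2.

Lemma sum_pure_delta (I : finType) (x : I -> free_lie n) i a :
  \sum_k pure (x k) ([ffun k => if k == i then a else 0] k) = pure (x i) a.
Proof.
rewrite (bigD1 i) //= ffunE eqxx big1 ?addr0 // => k /negbTE nk.
by rewrite ffunE nk; apply: biadd0r; exact: pure_tens_biadditive.
Qed.

Lemma sum_pure0 (I : finType) (x : I -> free_lie n) :
  \sum_k pure (x k) ((0 : {ffun I -> F}) k) = 0.
Proof. by apply: big1 => k _; rewrite ffunE; apply: biadd0r; exact: pure_tens_biadditive. Qed.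

Lemma sum_pureB (I : finType) (x : I -> free_lie n) (g h : {ffun I -> F}) :
  \sum_k pure (x k) ((g - h) k) = \sum_k pure (x k) (g k) - \sum_k pure (x k) (h k).
Proof.
apply: (canRL (addrK _)); rewrite -big_split; apply: eq_bigr => k _ /=.
by rewrite -pureDr !ffunE subrK.
Qed.

(** Right-normed words of length at most 3 span; antisymmetry orders the last two letters and the
    Jacobi identity brings the smallest letter into second place. Independence is obtained
    separately, from the pairing with the morphisms. *)
Lemma hall_combP (u : L) : exists a b d, u = hall_comb a b d.
Proof.
pose S (v : L) := exists a b d, v = hall_comb a b d.
have S0 : S 0 by exists 0, 0, 0; rewrite /hall_comb !sum_pure0 !addr0.
have SB v w : S v -> S w -> S (v - w).
  case=> [a [b [d ->]]] [a' [b' [d' ->]]]; exists (a - a'), (b - b'), (d - d').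
  have subE (x y z x' y' z' : L) : x + y + z - (x' + y' + z') = x - x' + (y - y') + (z - z').
    by rewrite (addrACA x) -opprD [RHS]addrACA -opprD.
  by rewrite /hall_comb !sum_pureB subE.
have SN v : S v -> S (- v) by rewrite -sub0r; exact: SB.
have SD v w : S v -> S w -> S (v + w) by move=> Sv Sw; rewrite -[w]opprK; apply/SB/SN.
have S1 i a : S (pure (e i) a).
  exists [ffun k => if k == i then a else 0], 0, 0.
  by rewrite /hall_comb sum_pure_delta !sum_pure0 !addr0.
have S2 (i j : 'I_n) a : (i < j)%N -> S (pure ⟦e i, e j⟧ a).
  move=> ltij; pose h : hall2 := exist _ (i, j) ltij.
  exists 0, [ffun k => if k == h then a else 0], 0.
  by rewrite /hall_comb sum_pure_delta !sum_pure0 addr0 add0r.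
have S3 (i j k : 'I_n) a : (j < k)%N -> (j <= i)%N -> S (pure ⟦e i, ⟦e j, e k⟧⟧ a).
  move=> ltjk leji; have ltijk : (j < k)%N && (j <= i)%N by rewrite ltjk.
  pose h : hall3 := exist _ (i, (j, k)) ltijk.
  exists 0, 0, [ffun k => if k == h then a else 0].
  by rewrite /hall_comb sum_pure_delta !sum_pure0 !add0r.
have pureN x a : pure (- x) a = - pure x a by rewrite raddfN pure_tensNl.
have S3' (i j k : 'I_n) a : (j < k)%N -> S (pure ⟦e i, ⟦e j, e k⟧⟧ a).
  move=> ltjk; have [leji|ltij] := leqP j i; first exact: S3.
  (* For i < j < k, both terms on the right are Hall elements with i in second place. *)
  have -> : ⟦e i, ⟦e j, e k⟧⟧ = ⟦e j, ⟦e i, e k⟧⟧ - ⟦e k, ⟦e i, e j⟧⟧.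
    by rewrite (lieC (e k)) opprK lie_leibniz addrC subrK.
  rewrite raddfB -[- nil_pi c _]raddfN pureDl pureN; apply: SB; apply: S3 => //.
  - exact: ltn_trans ltjk.
  - exact: ltnW.
  - by rewrite ltnW // (ltn_trans ltij).
move: u; apply: tens_ind => [|q a u Su]; first exact: S0.
apply: (SD) Su => {u}; have [x ->] := nil_pi_surj q.
elim: (lie_word_span x) => [|_ [w ->]|x1 x2 _ Sx1 _ Sx2]; first by rewrite raddf0 pure_tens0l.
  have [wle3|wgt3] := leqP (size w) 3; last first.
    suff -> : nil_pi c (lie_word w) = 0 by rewrite pure_tens0l.
    rewrite -(raddf0 (nil_pi c)); apply/nil_pi_eq; rewrite subr0.
    have := lie_word_lcs w; rewrite -(subnKC (leq_ltn_trans c_le3 wgt3)).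
    by elim: (size w - c.+1)%N => [|k IH]; rewrite ?addn0 // addnS => /lcsW.
  case: w wle3 => [|i [|j [|k []]]] //= _.
  - by rewrite raddf0 pure_tens0l.
  - have [ltij|ltji|/val_inj->] := ltngtP i j; first exact: S2.
      by rewrite lieC pureN; apply/SN/S2.
    by rewrite liexx raddf0 pure_tens0l.
  - have [ltjk|ltkj|/val_inj->] := ltngtP j k; first exact: S3'.
      by rewrite (lieC (e j)) lieNr pureN; apply/SN/S3'.
    by rewrite liexx lie0r raddf0 pure_tens0l.
by rewrite raddfB -[- nil_pi c _]raddfN pureDl pureN; apply: SB.
Qed.

End HallBasis.

(** * Coordinates of Hall combinations under a filiform morphism *)

Section HallCoordinates.
Variables (n c : nat) (F : finFieldType) (eps : F) (alpha gamma delta : 'I_n -> F).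
Hypothesis nil : c = 3%N \/ c = 2%N /\ eps = 0.
Local Notation L := (free_nil_tensor n c F).
Local Notation lift := (free_lift (filiform_gen eps alpha gamma delta)).
Local Notation hom := (@filiform_hom F eps n c alpha gamma delta).
Local Notation e := (@flie_gen n).

Lemma lift_gen i : lift (e i) = filiform_gen eps alpha gamma delta i.
Proof. exact: free_lift_pi. Qed.

Lemma lift_lie u v : lift ⟦u, v⟧ = ⟦lift u, lift v⟧.
Proof. exact: free_liftL. Qed.

Lemma co_hom_sum (k : {additive filiform eps -> F}) (I : finType) (x : I -> free_lie n)
    (g : {ffun I -> F}) : (forall a u, k (filiform_scale a u) = a * k u) ->
  k (hom (\sum_i pure_tens (nil_pi c (x i)) (g i))) = \sum_i g i * k (lift (x i)).
Proof.
move=> kZ; rewrite (raddf_sum hom) (raddf_sum k) /=.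
by apply: eq_bigr => i _; rewrite filiform_hom_pure.
Qed.

Lemma coZ_hall_elt2 h : coZ (lift (hall_elt2 h)) =
  alpha (val h).1 * delta (val h).2 - alpha (val h).2 * delta (val h).1.
Proof. by rewrite lift_lie co_lie !lift_gen. Qed.

Lemma coZ_hall_elt3 h : coZ (lift (hall_elt3 h)) = alpha (val h).1 *
  (eps * (alpha (val h).2.1 * gamma (val h).2.2 - alpha (val h).2.2 * gamma (val h).2.1)).
Proof. by rewrite !lift_lie !co_lie !lift_gen mul0r subr0. Qed.

Variables (a : {ffun 'I_n -> F}) (b : {ffun hall2 n -> F}) (d : {ffun hall3 n -> F}).
Local Notation u := (hall_comb c a b d).

Lemma coX_hall_comb : coX (hom u) = \sum_i a i * alpha i.
Proof.
rewrite !raddfD /= !(@co_hom_sum (@coX F eps)) //=.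
rewrite [X in _ + X + _]big1 ?addr0 => [|h _]; last by rewrite lift_lie mulr0.
rewrite [X in _ + X]big1 ?addr0 => [|h _]; last by rewrite lift_lie mulr0.
by apply: eq_bigr => i _; rewrite lift_gen.
Qed.

Lemma coY_hall_comb : coY (hom u) = \sum_i a i * gamma i.
Proof.
rewrite !raddfD /= !(@co_hom_sum (@coY F eps)) //=.
rewrite [X in _ + X + _]big1 ?addr0 => [|h _]; last by rewrite lift_lie mulr0.
rewrite [X in _ + X]big1 ?addr0 => [|h _]; last by rewrite lift_lie mulr0.
by apply: eq_bigr => i _; rewrite lift_gen.
Qed.

Lemma coW_hall_comb : coW (hom u) = \sum_i a i * delta i + \sum_h b h *
  (eps * (alpha (val h).1 * gamma (val h).2 - alpha (val h).2 * gamma (val h).1)).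
Proof.
rewrite !raddfD /= !(@co_hom_sum (@coW F eps)) //=.
rewrite [X in _ + X]big1 ?addr0 => [|h _]; last first.
  by rewrite !lift_lie !co_lie mulr0 mul0r subrr !mulr0.
congr (_ + _); apply: eq_bigr => i _; first by rewrite lift_gen.
by rewrite lift_lie co_lie !lift_gen.
Qed.

Lemma coZ_hall_comb : coZ (hom u) =
  \sum_h b h * coZ (lift (hall_elt2 h)) + \sum_h d h * coZ (lift (hall_elt3 h)).
Proof.
rewrite !raddfD /= !(@co_hom_sum (@coZ F eps)) //=.
by rewrite [X in X + _ + _]big1 ?add0r // => i _; rewrite lift_gen mulr0.
Qed.

End HallCoordinates.

Lemma sum_delta (F : pzRingType) (I : finType) (g : I -> F) (h : I) (k : F) :
  \sum_i g i * ((i == h)%:R * k) = g h * k.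
Proof.
by rewrite (bigD1 h) //= eqxx mul1r big1 ?addr0 // => i /negbTE->; rewrite mul0r mulr0.
Qed.

Lemma sum_delta1 (F : pzRingType) (I : finType) (g : I -> F) (h : I) :
  \sum_i g i * (i == h)%:R = g h.
Proof. by rewrite -[RHS]mulr1 -sum_delta; apply: eq_bigr => i _; rewrite mulr1. Qed.

(** The second product would require the pairs to be reversals of each other, which is impossible as
    both are increasing. *)
Lemma hall2_pairing n (F : pzRingType) (h k : hall2 n) :
  ((val k).1 == (val h).1)%:R * ((val k).2 == (val h).2)%:R -
  ((val k).2 == (val h).1)%:R * ((val k).1 == (val h).2)%:R = (k == h)%:R :> F.
Proof.
have -> : (k == h) = (val k == val h) by [].
case: k h => [[i j] /= ij] [[i' j'] /= ij']; rewrite xpair_eqE.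
case: (i =P i') => ei; case: (j =P j') => ej; case: (j =P i') => ji; case: (i =P j') => ij2;
  rewrite ?(mulr0, mul0r, subr0, mulr1) //; exfalso; subst; lia.
Qed.

(** Every index lies in an increasing pair: a positive one with 0, and 0 with 1. *)
Lemma hall2_cover n (V : zmodType) (a : {ffun 'I_n -> V}) : (2 <= n)%N ->
  (forall h : hall2 n, a (val h).1 = 0 /\ a (val h).2 = 0) -> a = 0.
Proof.
move=> n_ge2 E; apply/ffunP => i; rewrite ffunE.
have [lt0i|] := ltnP 0 i.
  by pose h : hall2 n := exist _ (Ordinal (ltnW n_ge2), i) lt0i; exact: (E h).2.
rewrite leqn0 => /eqP i0; have lt_i1 : (i < Ordinal n_ge2)%N by rewrite i0.
by pose h : hall2 n := exist _ (i, Ordinal n_ge2) lt_i1; exact: (E h).1.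
Qed.

(** * Class 2 *)

Section Class2.
Variables (R : realType) (n p f : nat) (F : finFieldType).
Hypotheses (n_ge2 : (2 <= n)%N) (p_prime : prime p) (card_F : #|F| = (p ^ f)%N).
Hypothesis p_ge3 : (3 <= p)%N.

(** With eps = 0 and gamma = 0 the image lies in the Heisenberg algebra of X, W, Z; for [e_i, e_j]
    the morphism sends e_i to X and e_j to W, so that the pairing with the basis is the identity
    matrix. *)
Let alpha (h : hall2 n) l : F := (l == (val h).1)%:R.
Let delta (h : hall2 n) l : F := (l == (val h).2)%:R.

Lemma m_faithful_class2 :
  m_faithful R [set: exp_lie (free_nil_tensor n 2 F)] = ((n ^ 2 - n) %/ 2 * f * p ^ f)%N.
Proof.
have nil : 2%N = 3%N \/ 2%N = 2%N /\ (0 : F) = 0 by right.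
rewrite -card_hall2.
apply: (@m_faithful_free_nil R F p f n 2 0 (hall2 n) alpha (fun _ _ => 0) delta
  (fun h => (val h).1) (fun h => flie_gen (val h).2)) => //.
- by move=> h; apply: lcsS.
- move=> x x0; apply/ffunP => h; rewrite ffunE -[LHS]sum_delta1 -[RHS](x0 h).
  by apply: eq_bigr => k _; rewrite [X in _ = _ * X]coZ_hall_elt2 hall2_pairing.
move=> u; have [a [b [d ->]]] := hall_combP (isT : (2 <= 3)%N) u => u0.
have E (h : hall2 n) : a (val h).1 = 0 /\ a (val h).2 = 0.
  have [X0 W0 _ _] := u0 h; split.
    by move: X0; rewrite coX_hall_comb // sum_delta1.
  move: W0; rewrite coW_hall_comb // sum_delta1 big1 ?addr0 // => k _.
  by rewrite mul0r mulr0.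
have a0 : a = 0 by exact: hall2_cover E.
have b0 : b = 0.
  apply/ffunP => h; rewrite ffunE -[LHS]sum_delta1.
  have [_ _ Z0 _] := u0 h; rewrite -[RHS]Z0 coZ_hall_comb // [X in _ = _ + X]big1 ?addr0 => [|k _].
    by apply: eq_bigr => k _; rewrite coZ_hall_elt2 hall2_pairing.
  by rewrite coZ_hall_elt3 mul0r !mulr0.
rewrite a0 b0 /hall_comb !sum_pure0 !add0r; apply: big1 => h _.
have -> : nil_pi 2 (hall_elt3 h) = 0.
  by rewrite -(raddf0 (nil_pi 2)); apply/nil_pi_eq; rewrite subr0; do 2!apply: lcsS.
exact: pure_tens0l.
Qed.

End Class2.

(** * Class 3 *)

Section Class3.
Variables (R : realType) (n p f : nat) (F : finFieldType).
Hypotheses (n_ge2 : (2 <= n)%N) (p_prime : prime p) (card_F : #|F| = (p ^ f)%N).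
Hypothesis p_ge5 : (5 <= p)%N.

(* The morphism attached to [e_i, [e_j, e_k]] has alpha = x_i + x_j and gamma = x_k if i <> k, and
   alpha = 2 x_k and gamma = x_j if i = k, where x_1, ..., x_n are the coordinates on L / [L, L].
   The pairing of these morphisms with the basis is triangular when the basis vectors in which only
   two letters occur are put first. *)
Let lo (h : hall3 n) := if (val h).1 == (val h).2.2 then (val h).1 else (val h).2.1.
Let hi (h : hall3 n) := if (val h).1 == (val h).2.2 then (val h).2.1 else (val h).2.2.
Let alpha (h : hall3 n) l : F := (l == (val h).1)%:R + (l == lo h)%:R.
Let gamma (h : hall3 n) l : F := (l == hi h)%:R.

Let two_letters (h : hall3 n) := ((val h).1 == (val h).2.1) || ((val h).1 == (val h).2.2).

(** The factor 1 is eps, kept to match [coZ_hall_elt3]. *)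
Let pairing (h k : hall3 n) : F := alpha h (val k).1 *
  (1 * (alpha h (val k).2.1 * gamma h (val k).2.2 - alpha h (val k).2.2 * gamma h (val k).2.1)).

Let two_neq0 : 2 != 0 :> F.
Proof.
have chF := card_finPcharP card_F p_prime.
by rewrite -(dvdn_pcharf chF) gtnNdvd //; lia.
Qed.

(** Here alpha is twice a single coordinate, so the pairing is 4 times an indicator times a 2 x 2
    minor; since j < k, only the diagonal entry survives, with a minus sign if i = k. *)
Let pairing_two h : two_letters h ->
  exists2 m, m != 0 & forall k, pairing h k = (k == h)%:R * m.
Proof.
have four_neq0 : 4 != 0 :> F by rewrite (natrM _ 2 2) mulf_neq0.
have kE (k : hall3 n) : (k == h) = (val k == val h) by [].
rewrite /two_letters; have [eik _|nik] := eqVneq (val h).1 (val h).2.2.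
  exists (- 4); first by rewrite oppr_eq0.
  move=> k; rewrite kE /pairing /alpha /gamma /lo /hi eik eqxx.
  case: h {kE} eik => [[i [j l]] /= hj]; case: k => [[i' [j' l']] /= kj] eil.
  rewrite !xpair_eqE; subst i.
  case: (i' =P l) => e1; case: (j' =P l) => e2; case: (j' =P j) => e3;
    case: (l' =P l) => e4; case: (l' =P j) => e5; rewrite /=;
    first [ring | exfalso; subst; first [congruence | lia]].
rewrite orbF => /eqP eij; exists 4 => // k; rewrite kE /pairing /alpha /gamma /lo /hi (negbTE nik).
case: h {kE} nik eij => [[i [j l]] /= hj]; case: k => [[i' [j' l']] /= kj] nil eij.
rewrite !xpair_eqE; subst i.
case: (i' =P j) => e1; case: (j' =P j) => e2; case: (j' =P l) => e3;
  case: (l' =P l) => e4; case: (l' =P j) => e5; rewrite /=;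
  first [ring | exfalso; subst; first [congruence | lia]].
Qed.

(** In both vectors the second letter is strictly the smallest, which excludes every nonzero term
    except the diagonal one. *)
Let pairing_three h k : ~~ two_letters h -> ~~ two_letters k -> pairing h k = (k == h)%:R.
Proof.
have -> : (k == h) = (val k == val h) by [].
rewrite /two_letters /pairing /alpha /gamma /lo /hi !negb_or.
move=> /andP[nij /negbTE nik]; rewrite nik; move: nij nik.
case: h => [[i [j l]] /= hj]; case: k => [[i' [j' l']] /= kj]; rewrite !xpair_eqE.
move=> /eqP nij /eqP nil /andP[/eqP nij' /eqP nil'].
have nij_nat : nat_of_ord i <> j by move/val_inj.
case: (i' =P i) => e1; case: (i' =P j) => e2; case: (j' =P i) => e3; case: (j' =P j) => e4;
 case: (l' =P i) => e5; case: (l' =P j) => e6; case: (l' =P l) => e7; case: (j' =P l) => e8;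
 rewrite /=; first [ring | exfalso; subst; first [congruence | lia]].
Qed.

Lemma m_faithful_class3 :
  m_faithful R [set: exp_lie (free_nil_tensor n 3 F)] = ((n ^ 3 - n) %/ 3 * f * p ^ f)%N.
Proof.
have nil : 3%N = 3%N \/ 3%N = 2%N /\ (1 : F) = 0 by left.
have top_inj (x : {ffun hall3 n -> F}) :
    (forall h, \sum_k x k * coZ (free_lift (filiform_gen 1 (alpha h) (gamma h) (fun=> 0))
      (hall_elt3 k)) = 0) -> x = 0.
  move=> x0; have {}x0 h : \sum_k x k * pairing h k = 0.
    by rewrite -[RHS](x0 h); apply: eq_bigr => k _; rewrite coZ_hall_elt3.
  (* The triangular system is solved first for the vectors with two letters, then for the others. *)
  have x2 h : two_letters h -> x h = 0.
    case/pairing_two => m nm pE; apply: (mulIf nm); rewrite mul0r -sum_delta -[RHS](x0 h).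
    by apply: eq_bigr => k _; rewrite pE.
  apply/ffunP => h; rewrite ffunE.
  have [/x2//|h3] := boolP (two_letters h).
  rewrite -[LHS]sum_delta1 -[RHS](x0 h); apply: eq_bigr => k _.
  by have [/x2->|k3] := boolP (two_letters k); rewrite ?mul0r // pairing_three.
rewrite -card_hall3.
apply: (@m_faithful_free_nil R F p f n 3 1 (hall3 n) alpha gamma (fun _ _ => 0)
  (fun h => (val h).1) (fun h => ⟦flie_gen (val h).2.1, flie_gen (val h).2.2⟧)) => //.
- by apply: leq_trans p_ge5.
- by apply: leq_trans p_ge5.
- by move=> h; do 2!apply: lcsS.
move=> u; have [a [b [d ->]]] := hall_combP (isT : (3 <= 3)%N) u => u0.
(* The morphism attached to [e_i, [e_i, e_j]] has alpha = 2 x_i and gamma = x_j, so its coordinates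
   X, Y and W recover the coefficients of degrees 1 and 2. *)
pose rep (h : hall2 n) : hall3 n :=
  exist _ ((val h).1, val h) (introT andP (conj (valP h) (leqnn (val h).1))).
have repE h : [/\ alpha (rep h) =1 (fun l => (l == (val h).1)%:R * 2)
    & gamma (rep h) =1 (fun l => (l == (val h).2)%:R)].
  case: h => [[i j] /= ij]; have /negbTE nij : i != j by apply/eqP => e; subst; lia.
  by split=> l; rewrite /alpha /gamma /lo /hi /= nij // mulr_natr.
have E (h : hall2 n) : a (val h).1 = 0 /\ a (val h).2 = 0.
  have [X0 _ _ [/eqP|Y0]] := u0 (rep h); first by rewrite oner_eq0.
  have [alphaE gammaE] := repE h; split.
    apply: (mulIf two_neq0); rewrite mul0r -[RHS]X0 coX_hall_comb // -sum_delta.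
    by apply: eq_bigr => l _; rewrite alphaE.
  rewrite -[RHS]Y0 coY_hall_comb // -[LHS]sum_delta1.
  by apply: eq_bigr => l _; rewrite gammaE.
have a0 : a = 0 by exact: hall2_cover E.
have b0 : b = 0.
  apply/ffunP => h; rewrite ffunE; have [_ W0 _ _] := u0 (rep h).
  have [alphaE gammaE] := repE h.
  apply: (mulIf two_neq0); rewrite mul0r -[RHS]W0 coW_hall_comb // [X in X + _]big1 ?add0r.
    rewrite -sum_delta; apply: eq_bigr => k _; congr (_ * _).
    by rewrite !alphaE !gammaE -hall2_pairing; ring.
  by move=> i _; rewrite mulr0.
(* As delta = 0, degree 2 does not contribute to Z, and the coefficients of degree 3 satisfy the
   system solved in [top_inj]. *)
have d0 : d = 0.
  apply: top_inj => h; have [_ _ Z0 _] := u0 h.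
  rewrite -[RHS]Z0 coZ_hall_comb // [X in _ = X + _]big1 ?add0r // => k _.
  by rewrite coZ_hall_elt2 !mulr0 subrr mulr0.
by rewrite a0 b0 d0 /hall_comb !sum_pure0 !addr0.
Qed.

End Class3.

Theorem theorem2p13 (R : realType) (n p f q : nat) (F : finFieldType)
    (n_ge2 : (2 <= n)%N) (p_prime : prime p) (q_def : q = (p ^ f)%N) (card_F : #|F| = q) :
  ((3 <= p)%N ->
     m_faithful R [set: exp_lie (free_nil_tensor n 2 F)] = ((n ^ 2 - n) %/ 2 * f * q)%N)
  /\
  ((5 <= p)%N ->
     m_faithful R [set: exp_lie (free_nil_tensor n 3 F)] = ((n ^ 3 - n) %/ 3 * f * q)%N).
Proof.
subst q; split=> p_ge; first exact: m_faithful_class2.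
exact: m_faithful_class3.
Qed.
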